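(* Let $\omega,\omega'$ be connection forms, let $\mathcal L$ act on $\overline{\mathfrak g}$ via $e\mapsto\nabla^{(\omega')}_e$, and let $C$ be a differentiable cycle on $\Sigma$ not meeting $\{P_+,P_-\}\cup W$. (a) The cocycle $\gamma_{2,C}$ is $\mathcal L$-invariant (with respect to $\omega'$). (b) If $\omega=\omega'$, then the cocycle $\gamma_{1,\omega,C}$ is $\mathcal L$-invariant (with respect to $\omega'$).
   Context: Setting. $\Sigma$ is a compact Riemann surface of genus $g$ with two distinct marked points $P_+,P_-$; $n\in\mathbb N$; $W=\{\gamma_1,\dots,\gamma_{ng}\}\subset\Sigma\setminus\{P_+,P_-\}$ is a set of $ng$ further points, all marked points being in generic position; $z_s$ is a fixed local coordinate centred at $\gamma_s$. $\mathfrak g$ is one of the complex matrix Lie algebras $\mathfrak{gl}(n)$, $\mathfrak{sl}(n)$, $\mathfrak{so}(n)$ (skew-symmetric matrices), $\mathfrak{sp}(2n)=\{X: X^t\sigma+\sigma X=0\}$ ($\sigma$ a nondegenerate skew-symmetric $2n\times 2n$ matrix), $\mathfrak s(n)$ (scalar $n\times n$ matrices). To each $\gamma_s$ a vector $\alpha_s\in\mathbb C^n$ is attached ($\alpha_s\in\mathbb C^{2n}$ for $\mathfrak{sp}(2n)$; $\alpha_s^t\alpha_s=0$ for $\mathfrak{so}(n)$). Lax operator algebra. $\overline{\mathfrak g}$ is the Lie algebra, under the pointwise commutator, of all meromorphic $L:\Sigma\to\mathfrak g$, holomorphic outside $W\cup\{P_+,P_-\}$, whose Laurent expansion $L=\sum_k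 L_{s,k}z_s^k$ at each $\gamma_s$ satisfies: for $\mathfrak{gl}(n),\mathfrak{sl}(n)$: $L_{s,k}=0$ for $k<-1$ and there are $\beta_s\in\mathbb C^n,\kappa_s\in\mathbb C$ with $L_{s,-1}=\alpha_s\beta_s^t$, $\beta_s^t\alpha_s=0$, $L_{s,0}\alpha_s=\kappa_s\alpha_s$; for $\mathfrak{so}(n)$: the same with $L_{s,-1}=\alpha_s\beta_s^t-\beta_s\alpha_s^t$; for $\mathfrak{sp}(2n)$: $L_{s,k}=0$ for $k<-2$ and there are $\beta_s\in\mathbb C^{2n},\nu_s,\kappa_s\in\mathbb C$ with $L_{s,-2}=\nu_s\alpha_s\alpha_s^t\sigma$, $L_{s,-1}=(\alpha_s\beta_s^t+\beta_s\alpha_s^t)\sigma$, $\beta_s^t\sigma\alpha_s=0$, $L_{s,0}\alpha_s=\kappa_s\alpha_s$, $\alpha_s^t\sigma L_{s,1}\alpha_s=0$; for $\mathfrak s(n)$: $L$ is holomorphic at $W$. $\mathcal L$ is the Lie algebra of meromorphic vector fields on $\Sigma$ holomorphic outside $\{P_+,P_-\}$. Connection forms. A connection form $\omega$ is a meromorphic matrix-valued 1-form on $\Sigma$, with values in $\mathfrak g$ for $\mathfrak{so}(n),\mathfrak{sp}(2n)$ and in $\mathfrak{gl}(n)$ for $\mathfrak{gl}(n),\mathfrak{sl}(n),\mathfrak s(n)$, holomorphic outside $W\cup\{P_-\}$ (in particular holomorphic at $P_+$), holomorphic at $\gamma_s$ if $\alpha_s=0$, and if $\alpha_s\ne0$ with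 expansion $\omega=(\omega_{s,-1}z_s^{-1}+\omega_{s,0}+\omega_{s,1}z_s+\cdots)dz_s$ such that for some vector $\tilde\beta_s$ and $\tilde\kappa_s\in\mathbb C$: $\omega_{s,0}\alpha_s=\tilde\kappa_s\alpha_s$ and ($\mathfrak{gl},\mathfrak{sl},\mathfrak s$) $\omega_{s,-1}=\alpha_s\tilde\beta_s^t$, $\tilde\beta_s^t\alpha_s=1$; ($\mathfrak{so}$) $\omega_{s,-1}=\alpha_s\tilde\beta_s^t-\tilde\beta_s\alpha_s^t$, $\tilde\beta_s^t\alpha_s=1$; ($\mathfrak{sp}$) $\omega_{s,-1}=(\alpha_s\tilde\beta_s^t+\tilde\beta_s\alpha_s^t)\sigma$, $\tilde\beta_s^t\sigma\alpha_s=1$, $\alpha_s^t\sigma\omega_{s,1}\alpha_s=0$. Put $\nabla^{(\omega)}L=dL+[\omega,L]$ and $\nabla^{(\omega)}_eL=e\,.\,L+[\omega(e),L]$ for $e\in\mathcal L$ ($e\,.\,L$: entrywise derivative). Cocycles. The geometric cocycles on $\overline{\mathfrak g}$ are $$\gamma_{1,\omega,C}(L,L')=\frac1{2\pi i}\int_C\operatorname{tr}(L\cdot\nabla^{(\omega)}L'),\qquad \gamma_{2,C}(L,L')=\frac1{2\pi i}\int_C\operatorname{tr}(L)\operatorname{tr}(\nabla^{(\omega)}L')=\frac1{2\pi i}\int_C\operatorname{tr}(L)\operatorname{tr}(dL').$$ A cocycle $\gamma$ is $\mathcal L$-invariant with respect to $\omega'$ if $\gamma(\nabla^{(\omega')}_eL,L')+\gamma(L,\nabla^{(\omega')}_eL')=0$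 for all $e\in\mathcal L$, $L,L'\in\overline{\mathfrak g}$. *)

(* Defs.v *)
(* The complex numbers are R[i] for R : realType. *)
From Stdlib Require List.
From HB Require Import structures.
From mathcomp Require Import all_boot all_order all_algebra.
From mathcomp Require Import all_classical all_reals all_analysis.
From mathcomp Require Import complex.

Set Implicit Arguments.
Unset Strict Implicit.
Unset Printing Implicit Defensive.

Import Order.TTheory GRing.Theory Num.Theory numFieldNormedType.Exports.

Local Open Scope classical_set_scope.
Local Open Scope ring_scope.
Local Open Scope complex_scope.

Section OneVariable.
Variable R : realType.
Local Notation C := R[i].

(* R[i]^o is R[i] as a normed module over itself; it carries the topology. *)
Definition cderiv (f : C -> C) (z : C) : C := derive1 (f : C -> C^o) z.

(* f(z) = \sum_(k >= -m) a_k (z - z0)^k for z in a punctured disc around z0,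
   for some m, so that the principal part is finite. *)
Definition has_laurent (f : C -> C) (z0 : C) (a : int -> C) : Prop :=
  exists m : nat, (forall k : int, k < - m%:Z -> a k = 0) /\
  exists2 r : C, 0 < r & forall z : C, 0 < `|z - z0| < r ->
    series (fun j : nat => a (j%:Z - m%:Z) * (z - z0) ^ (j%:Z - m%:Z))
      @ \oo --> (f z : C^o).

(* The value of f at z0 itself is irrelevant here. *)
Definition meromorphic_at (f : C -> C) (z0 : C) : Prop :=
  exists a : int -> C, has_laurent f z0 a.

(* Convergent power series expansion, including at the centre z0. *)
Definition holomorphic_at (f : C -> C) (z0 : C) : Prop :=
  exists a : int -> C,
    [/\ has_laurent f z0 a, forall k : int, k < 0 -> a k = 0 & f z0 = a 0].

End OneVariable.

(* A homeomorphism from an open set of X onto an open set of the complex plane;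
   cmap and cinv are total, with irrelevant values outside these open sets. *)
Record chart (R : realType) (X : topologicalType) := Chart {
  cdom : set X;
  cmap : X -> R[i];
  cinv : R[i] -> X;
  cdom_open : open cdom;
  cimg_open : open (cmap @` cdom : set R[i]^o);
  cmapK : {in cdom, cancel cmap cinv};
  cmap_cont : forall x, cdom x -> {for x, continuous (cmap : X -> R[i]^o)};
  cinv_cont : forall z, (cmap @` cdom) z -> {for z, continuous (cinv : R[i]^o -> X)} }.

Definition transition (R : realType) (X : topologicalType) (c c' : chart R X) :
  R[i] -> R[i] := cmap c' \o cinv c.

Definition compatible (R : realType) (X : topologicalType) (c c' : chart R X) :=
  forall x, cdom c x -> cdom c' x ->
    holomorphic_at (transition c c') (cmap c x) /\
    holomorphic_at (transition c' c) (cmap c' x).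

(* The atlas is maximal, so that its members are exactly the holomorphic local
   coordinates. *)
Record riemann_surface (R : realType) := RiemannSurface {
  rs_space :> topologicalType;
  atlas : set (chart R rs_space);
  rs_hausdorff : hausdorff_space rs_space;
  rs_connected : connected [set: rs_space];
  atlas_cover : forall x : rs_space, exists2 c, atlas c & cdom c x;
  atlas_compatible : forall c c', atlas c -> atlas c' -> compatible c c';
  atlas_maximal : forall c, (forall c', atlas c' -> compatible c c') -> atlas c }.

Section Surface.
Variables (R : realType) (X : riemann_surface R).
Local Notation C := R[i].
Local Notation chartX := (chart R X).

Definition chart_at (x : X) : chartX := s2val (cid2 (atlas_cover x)).

(* Scalar and matrix functions, 1-forms and vector fields are all given by one
   coefficient for each chart, F : chartX -> X -> _ : the coefficient does not
   depend on the chart for a function, and for a form (resp. vector field) it is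
   F c in F c dz (resp. F c d/dz), z being the coordinate of c. *)

Definition hol_at (f : chartX -> X -> C) (x : X) : Prop :=
  forall c, atlas c -> cdom c x -> holomorphic_at (f c \o cinv c) (cmap c x).

Definition mer_at (f : chartX -> X -> C) (x : X) : Prop :=
  forall c, atlas c -> cdom c x -> meromorphic_at (f c \o cinv c) (cmap c x).

Definition mx_hol_at N (F : chartX -> X -> 'M[C]_N) (x : X) : Prop :=
  forall i j, hol_at (fun c y => F c y i j) x.

Definition mx_mer_at N (F : chartX -> X -> 'M[C]_N) (x : X) : Prop :=
  forall i j, mer_at (fun c y => F c y i j) x.

(* F c = \sum_k A k * z^k around x, with z = cmap c - cmap c x. *)
Definition mx_laurent N (c : chartX) (F : chartX -> X -> 'M[C]_N) (x : X)
    (A : int -> 'M[C]_N) : Prop :=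
  forall i j,
    has_laurent ((fun y => F c y i j) \o cinv c) (cmap c x) (fun k => A k i j).

Definition is_form (V : lmodType C) (w : chartX -> X -> V) : Prop :=
  forall c c' x, atlas c -> atlas c' -> cdom c x -> cdom c' x ->
    w c x = cderiv (transition c c') (cmap c x) *: w c' x.

Definition is_vector_field (e : chartX -> X -> C) : Prop :=
  forall c c' x, atlas c -> atlas c' -> cdom c x -> cdom c' x ->
    e c' x = cderiv (transition c c') (cmap c x) * e c x.

Definition holomorphic_form (w : chartX -> X -> C) : Prop :=
  is_form (w : chartX -> X -> C^o) /\ forall x, hol_at w x.

(* g is the dimension of the space of holomorphic 1-forms. *)
Definition has_genus (g : nat) : Prop :=
  exists2 eta : 'I_g -> chartX -> X -> C,
    forall i, holomorphic_form (eta i) &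
    forall w, holomorphic_form w ->
      exists! a : 'rV[C]_g, forall c x, atlas c -> cdom c x ->
        w c x = \sum_i a 0 i * eta i c x.

Definition fun_d (f : X -> C) : chartX -> X -> C :=
  fun c x => cderiv (f \o cinv c) (cmap c x).

Definition mx_d N (L : X -> 'M[C]_N) : chartX -> X -> 'M[C]_N :=
  fun c x => \matrix_(i, j) fun_d (fun y => L y i j) c x.

(* A curve parametrized by [0, 1] that is C^1 on a neighbourhood of [0, 1];
   piecewise C^1 curves are chains of these. *)
Definition C1_curve (p : R -> X) : Prop :=
  forall t : R, 0 <= t <= 1 ->
    {for t, continuous p} /\
    forall c, atlas c -> cdom c (p t) ->
      [/\ \forall u \near t, derivable (fun v => complex.Re (cmap c (p v))) u 1,
          \forall u \near t, derivable (fun v => complex.Im (cmap c (p v))) u 1,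
          {for t, continuous (derive1 (fun v => complex.Re (cmap c (p v))))} &
          {for t, continuous (derive1 (fun v => complex.Im (cmap c (p v))))}].

Definition velocity (p : R -> X) (c : chartX) (t : R) : C :=
  derive1 (fun v => complex.Re (cmap c (p v))) t +i*
  derive1 (fun v => complex.Im (cmap c (p v))) t.

Definition curve_int (p : R -> X) (w : chartX -> X -> C) : C :=
  let h t := let c := chart_at (p t) in w c (p t) * velocity p c t in
  Rintegral lebesgue_measure `[0, 1] (fun t => complex.Re (h t)) +i*
  Rintegral lebesgue_measure `[0, 1] (fun t => complex.Im (h t)).

(* Singular 1-chains are formal integer combinations of curves. *)
Definition chain := seq (int * (R -> X)).

Definition in_chain (s : chain) (p : R -> X) : Prop := exists m, List.In (m, p) s.

(* The last clause says that the boundary vanishes in the free abelian group on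
   the points of X. *)
Definition differentiable_cycle (s : chain) : Prop :=
  (forall p, in_chain s p -> C1_curve p) /\
  forall x : X,
    \sum_(mp <- s) mp.1 * ((mp.2 1 == x)%:Z - (mp.2 0 == x)%:Z) = 0.

Definition chain_avoids (s : chain) (S : set X) : Prop :=
  forall p, in_chain s p -> forall t : R, 0 <= t <= 1 -> ~ S (p t).

Definition chain_int (s : chain) (w : chartX -> X -> C) : C :=
  \sum_(mp <- s) mp.1%:~R * curve_int mp.2 w.

End Surface.

Inductive lie_type := Lie_gl | Lie_sl | Lie_so | Lie_sp | Lie_s.

Definition lie_dim (T : lie_type) (n : nat) : nat :=
  if T is Lie_sp then (2 * n)%N else n.

Definition commutator (K : comNzRingType) N (A B : 'M[K]_N) : 'M[K]_N :=
  A *m B - B *m A.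

(* sigma is only used for sp. *)
Definition in_lie (K : comNzRingType) (T : lie_type) N (sigma A : 'M[K]_N) : Prop :=
  match T with
  | Lie_gl => True
  | Lie_sl => \tr A = 0
  | Lie_so => A^T = - A
  | Lie_sp => A^T *m sigma + sigma *m A = 0
  | Lie_s => exists a : K, A = a%:M
  end.

(* A k is the k-th coefficient of L at gamma_s, and al is alpha_s. *)
Definition lax_expansion (K : comNzRingType) (T : lie_type) N
    (sigma : 'M[K]_N) (al : 'cV[K]_N) (A : int -> 'M[K]_N) : Prop :=
  match T with
  | Lie_gl | Lie_sl =>
      (forall k, k < -1 -> A k = 0) /\
      exists (be : 'cV[K]_N) (ka : K),
        [/\ A (-1) = al *m be^T, be^T *m al = 0 & A 0 *m al = ka *: al]
  | Lie_so =>
      (forall k, k < -1 -> A k = 0) /\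
      exists (be : 'cV[K]_N) (ka : K),
        [/\ A (-1) = al *m be^T - be *m al^T, be^T *m al = 0 &
            A 0 *m al = ka *: al]
  | Lie_sp =>
      (forall k, k < -2 -> A k = 0) /\
      exists (be : 'cV[K]_N) (nu ka : K),
        [/\ A (-2) = nu *: (al *m al^T *m sigma),
            A (-1) = (al *m be^T + be *m al^T) *m sigma,
            be^T *m sigma *m al = 0,
            A 0 *m al = ka *: al &
            al^T *m sigma *m A 1 *m al = 0]
  | Lie_s => forall k, k < 0 -> A k = 0
  end.

Definition connection_expansion (K : comNzRingType) (T : lie_type) N
    (sigma : 'M[K]_N) (al : 'cV[K]_N) (A : int -> 'M[K]_N) : Prop :=
  (al = 0 -> forall k, k < 0 -> A k = 0) /\
  (al <> 0 -> (forall k, k < -1 -> A k = 0) /\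
    exists (be : 'cV[K]_N) (ka : K), A 0 *m al = ka *: al /\
      match T with
      | Lie_gl | Lie_sl | Lie_s => A (-1) = al *m be^T /\ be^T *m al = 1%:M
      | Lie_so => A (-1) = al *m be^T - be *m al^T /\ be^T *m al = 1%:M
      | Lie_sp =>
          [/\ A (-1) = (al *m be^T + be *m al^T) *m sigma,
              be^T *m sigma *m al = 1%:M &
              al^T *m sigma *m A 1 *m al = 0]
      end).

(* The points P_+, P_-, gamma_s, the local coordinates z_s, the vectors alpha_s
   and the matrix sigma. *)
Record marking (R : realType) (X : riemann_surface R) (g n : nat) (T : lie_type) :=
  Marking {
    Pplus : X;
    Pminus : X;
    gam : 'I_(n * g) -> X;
    zloc : 'I_(n * g) -> chart R X;
    alpha : 'I_(n * g) -> 'cV[R[i]]_(lie_dim T n);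
    sigma : 'M[R[i]]_(lie_dim T n);
    Pplus_neq_Pminus : Pplus <> Pminus;
    gam_inj : injective gam;
    gam_neq_P : forall s, gam s <> Pplus /\ gam s <> Pminus;
    zloc_atlas : forall s, atlas (zloc s);
    zloc_centred : forall s, cdom (zloc s) (gam s) /\ cmap (zloc s) (gam s) = 0;
    alpha_so : T = Lie_so -> forall s, (alpha s)^T *m alpha s = 0;
    sigma_sp : T = Lie_sp -> sigma^T = - sigma /\ sigma \in unitmx }.

Section LaxOperators.
Variables (R : realType) (X : riemann_surface R) (g n : nat) (T : lie_type).
Variable D : marking X g n T.
Local Notation C := R[i].
Local Notation chartX := (chart R X).
Local Notation N := (lie_dim T n).

Definition marked_P : set X := [set x | x = Pplus D \/ x = Pminus D].
Definition marked_W : set X := range (gam D).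

(* Meromorphic functions are total functions whose values at the marked points
   are irrelevant. *)
Definition lax_operator (L : X -> 'M[C]_N) : Prop :=
  let F : chartX -> X -> 'M[C]_N := fun=> L in
  [/\ forall x, ~ (marked_P `|` marked_W) x -> in_lie T (sigma D) (L x),
      forall x, ~ (marked_P `|` marked_W) x -> mx_hol_at F x,
      forall x, (marked_P `|` marked_W) x -> mx_mer_at F x &
      forall s, exists2 A : int -> 'M[C]_N,
        mx_laurent (zloc D s) F (gam D s) A &
        lax_expansion T (sigma D) (alpha D s) A].

Definition mer_vector_field (e : chartX -> X -> C) : Prop :=
  [/\ is_vector_field e,
      forall x, ~ marked_P x -> hol_at e x &
      forall x, marked_P x -> mer_at e x].

Definition connection_values (A : 'M[C]_N) : Prop :=
  match T with
  | Lie_so | Lie_sp => in_lie T (sigma D) A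
  | Lie_gl | Lie_sl | Lie_s => True
  end.

Definition connection_form (w : chartX -> X -> 'M[C]_N) : Prop :=
  [/\ is_form w,
      forall c x, atlas c -> cdom c x -> ~ (marked_W `|` [set Pminus D]) x ->
        connection_values (w c x),
      forall x, ~ (marked_W `|` [set Pminus D]) x -> mx_hol_at w x,
      forall x, (marked_W `|` [set Pminus D]) x -> mx_mer_at w x &
      forall s, exists2 A : int -> 'M[C]_N,
        mx_laurent (zloc D s) w (gam D s) A &
        connection_expansion T (sigma D) (alpha D s) A].

Definition nabla (w : chartX -> X -> 'M[C]_N) (L : X -> 'M[C]_N) :
    chartX -> X -> 'M[C]_N :=
  fun c x => mx_d L c x + commutator (w c x) (L x).

(* e . L and w(e), which do not depend on the chart used to compute them. *)
Definition lie_deriv (e : chartX -> X -> C) (L : X -> 'M[C]_N) (x : X) : 'M[C]_N :=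
  e (chart_at x) x *: mx_d L (chart_at x) x.

Definition contract (w : chartX -> X -> 'M[C]_N) (e : chartX -> X -> C) (x : X) :
    'M[C]_N :=
  e (chart_at x) x *: w (chart_at x) x.

Definition nabla_along (w : chartX -> X -> 'M[C]_N) (e : chartX -> X -> C)
    (L : X -> 'M[C]_N) (x : X) : 'M[C]_N :=
  lie_deriv e L x + commutator (contract w e x) (L x).

Definition two_pi_i : C := 2 * (pi : R)%:C * 'i.

Definition gamma1 (w : chartX -> X -> 'M[C]_N) (s : chain X)
    (L L' : X -> 'M[C]_N) : C :=
  two_pi_i^-1 * chain_int s (fun c x => \tr (L x *m nabla w L' c x)).

(* As tr [w, L'] = 0 this does not depend on w: nabla w L' can be replaced by
   mx_d L'. *)
Definition gamma2 (w : chartX -> X -> 'M[C]_N) (s : chain X)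
    (L L' : X -> 'M[C]_N) : C :=
  two_pi_i^-1 * chain_int s (fun c x => \tr (L x) * \tr (nabla w L' c x)).

Definition invariant_cocycle (w : chartX -> X -> 'M[C]_N)
    (gamma : (X -> 'M[C]_N) -> (X -> 'M[C]_N) -> C) : Prop :=
  forall e L L', mer_vector_field e -> lax_operator L -> lax_operator L' ->
    gamma (nabla_along w e L) L' + gamma L (nabla_along w e L') = 0.

End LaxOperators.

(* Main.v *)
Require Import Defs.
From mathcomp Require Import all_boot all_order all_algebra.
From mathcomp Require Import all_classical all_reals all_analysis.
From mathcomp Require Import complex.
From mathcomp Require Import ring.

(** For either cocycle, the sum that has to vanish is the integral over a cycle of
    the differential of a function.  In a local coordinate put
    [D = d/dz + [w, -]], so that [nabla w L = D L dz] and
    [nabla_along w e L = e * D L].  Since the trace of a commutator vanishes,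
    [[
      tr (e DL * DL') + tr (L * D (e DL')) = d/dz tr (L * (e DL')),
    ]]
    and in the same way, for any two connections,
    [[
      tr (e DL) * tr (DL') + tr L * tr (D (e DL')) = d/dz (tr L * tr (e DL')).
    ]]
    The right hand sides are differentials of functions on the complement of the
    marked points, where the cycle lies, and the integral of a differential
    over a cycle is zero.

    Most of the text supplies the analysis behind these lines.  A function that is
    locally a convergent power series has a derivative of the same kind
    ([analytic_at_derive1]), so the functions above are continuously
    differentiable in every chart ([nabla_along_C1]) and the integrands are
    continuous forms.  Along a curve the integrand is then continuous and does not
    depend on the charts chosen to compute it ([pullback_continuous]); hence the
    integral is additive, and on a differential it is the difference of the values
    at the end points ([curve_int_fun_d]).  For a cycle these differences add up
    to zero ([chain_int_exact]).  The two identities are [tr_nabla_exact] and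
    [tr_tr_nabla_exact]. *)

Set Implicit Arguments.
Unset Strict Implicit.
Unset Printing Implicit Defensive.

Import Order.TTheory GRing.Theory Num.Theory numFieldNormedType.Exports.
Local Open Scope classical_set_scope.
Local Open Scope ring_scope.

(** * Derivatives of power series *)

Section PowerSeries.
Variable K : numFieldType.
Implicit Types (f g : K -> K) (b : nat -> K) (x y z r : K).

Definition power_series_at f z b r :=
  0 < r /\ forall y, `|y - z| < r ->
    series (fun j => b j * (y - z) ^+ j) @ \oo --> f y.

Definition analytic_at f z := exists b r, power_series_at f z b r.

Lemma norm_subX_le x y r n : `|x| <= r -> `|y| <= r ->
  `|x ^+ n - y ^+ n| <= `|x - y| * (n%:R * r ^+ n.-1).
Proof.
move=> xr yr; rewrite subrXX normrM ler_wpM2l //.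
apply: (le_trans (ler_norm_sum _ _ _)).
have -> : n%:R * r ^+ n.-1 = \sum_(i < n) r ^+ n.-1.
  by rewrite sumr_const card_ord mulr_natl.
apply: ler_sum => i _; rewrite normrM !normrX.
have -> : r ^+ n.-1 = r ^+ (n.-1 - i) * r ^+ i.
  by rewrite -exprD subnK // -ltnS (ltn_predK (ltn_ord i)).
by rewrite ler_pM ?exprn_ge0 // lerXn2r // nnegrE // (le_trans _ xr).
Qed.

Lemma power_series_coef_bound {f z b r} : power_series_at f z b r ->
  exists2 M, 0 <= M & forall k, `|b k| * (r / 2) ^+ k <= M.
Proof.
move=> [r0 /(_ (z + r / 2)) h].
have r2 : `|z + r / 2 - z| = r / 2.
  by rewrite addrAC subrr add0r gtr0_norm // divr_gt0.
have /h cs : `|z + r / 2 - z| < r by rewrite r2 ltr_pdivrMr // ltr_pMr // ltr1n.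
have /cvg_series_cvg_0 c0 : cvgn (series (fun j => b j * (z + r / 2 - z) ^+ j)).
  by apply/cvg_ex; exists (f (z + r / 2)).
have [M [Mr HM]] : bounded_fun (fun j => b j * (z + r / 2 - z) ^+ j).
  by apply: cvg_seq_bounded; apply/cvg_ex; exists 0.
exists (`|M| + 1); first by rewrite addr_ge0.
move=> k; have := HM (`|M| + 1) _ k I.
rewrite /= normrM normrX r2; apply.
by rewrite (le_lt_trans (real_ler_norm Mr)) // ltrDl.
Qed.

Lemma sum_geometric_half_le m n :
  \sum_(m <= k < n) (2^-1 : K) ^+ k <= 2 * 2^-1 ^+ m.
Proof.
have [mn|nm] := leqP m n; last first.
  by rewrite big_geq 1?ltnW // mulr_ge0 // exprn_ge0 // invr_ge0.
suff -> : \sum_(m <= k < n) (2^-1 : K) ^+ k = 2 * (2^-1 ^+ m - 2^-1 ^+ n).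
  by rewrite ler_wpM2l // lerBlDr lerDl exprn_ge0 // invr_ge0.
rewrite mulrBr.
have -> : 2 * 2^-1 ^+ m - 2 * 2^-1 ^+ n = - (2 * 2^-1 ^+ n) - - (2 * 2^-1 ^+ m) :> K.
  by rewrite opprK addrC.
rewrite -(telescope_sumr (fun k => - (2 * (2^-1 : K) ^+ k))) //.
apply: eq_bigr => k _; rewrite exprS mulrA mulfV ?pnatr_eq0 // mul1r.
by rewrite opprK addrC mulr2n mulrDl mul1r addrK.
Qed.

Lemma norm_lim_le {T : Type} {F : set_system T} {FF : ProperFilter F}
    (g : T -> K) (l B : K) :
  g @ F --> l -> (\forall t \near F, `|g t| <= B) -> `|l| <= B.
Proof.
move=> gl gB; apply/ler_addgt0Pr => e e0.
have /filter_ex[t [lt tB]] : \forall t \near F, `|l - g t| <= e /\ `|g t| <= B.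
  by apply: filterI => //; move/cvgrPdist_le: gl; exact.
by rewrite -[l](subrK (g t)) addrC (le_trans (ler_normD _ _)) // lerD.
Qed.

(** Cauchy's estimate [|b k| (r/2)^k <= M] makes the tails of the power series
    Lipschitz near the centre, with constants decaying geometrically.  Continuity
    of the sum and termwise differentiation both follow from this one estimate:
    a Lipschitz bound on a tail is a bound on its derivative. *)
Lemma power_series_tail_lipschitz {f z b r} : power_series_at f z b r ->
  exists2 d, 0 < d & exists2 M, 0 <= M &
  forall n x y, `|x - z| <= d -> `|y - z| <= d ->
    `|(f x - series (fun j => b j * (x - z) ^+ j) n) -
      (f y - series (fun j => b j * (y - z) ^+ j) n)| <=
    M * 2^-1 ^+ n * `|x - y|.
Proof.
move=> hf; have [M M0 HM] := power_series_coef_bound hf.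
case: hf => r0 hf.
(* On the disc of radius d the k-th term has Lipschitz constant at most
   |b k| k d^(k-1) <= (M / d) k 4^-k <= (M / d) 2^-k, using k <= 2^k. *)
pose d := r / 2 / 4.
have d0 : 0 < d by rewrite !divr_gt0.
have dr : d < r.
  by rewrite /d -mulrA -invfM ltr_pdivrMr ?mulr_gt0 // ltr_pMr // -natrM ltr1n.
exists d => //; exists (M / d * 2); first by rewrite mulr_ge0 // divr_ge0 // ltW.
move=> n x y xd yd.
have := hf x (le_lt_trans xd dr); have := hf y (le_lt_trans yd dr).
set u := series _; set v := series _ => uy vx.
have vu : (v m - v n) - (u m - u n) @[m --> \oo] --> (f x - v n) - (f y - u n).
  by apply: cvgB; [apply: cvgB => //; exact: cvg_cst |
                   apply: cvgB => //; exact: cvg_cst].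
apply: (norm_lim_le vu); near=> m.
have nm : (n <= m)%N by near: m; exact: nbhs_infty_ge.
rewrite /u /v !sub_series_geq // -sumrB (le_trans (ler_norm_sum _ _ _)) //.
apply: (@le_trans _ _ (\sum_(n <= k < m) M / d * `|x - y| * 2^-1 ^+ k)); last first.
  rewrite -mulr_sumr.
  have -> : M / d * 2 * 2^-1 ^+ n * `|x - y| = M / d * `|x - y| * (2 * 2^-1 ^+ n).
    by ring.
  by rewrite ler_wpM2l ?sum_geometric_half_le // mulr_ge0 // divr_ge0 // ltW.
apply: ler_sum => k _; rewrite -mulrBr normrM.
have le1 : `|(x - z) ^+ k - (y - z) ^+ k| <= `|x - y| * (k%:R * d ^+ k.-1).
  have -> : x - y = (x - z) - (y - z) by rewrite opprB addrA subrK.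
  exact: norm_subX_le.
apply: (le_trans (ler_wpM2l (normr_ge0 _) le1)).
have -> : `|b k| * (`|x - y| * (k%:R * d ^+ k.-1)) =
    `|x - y| * (`|b k| * (k%:R * d ^+ k.-1)) by ring.
rewrite [M / d * _]mulrC -mulrA ler_wpM2l //.
case: k {le1} => [|k].
  by rewrite mul0r mulr0 mulr_ge0 // ?exprn_ge0 ?invr_ge0 // divr_ge0 // ltW.
have kle : k.+1%:R * 4^-1 ^+ k.+1 <= 2^-1 ^+ k.+1 :> K.
  have -> : 4^-1 ^+ k.+1 = 2^-1 ^+ k.+1 * 2^-1 ^+ k.+1 :> K.
    by rewrite -exprMn -invfM -natrM.
  rewrite mulrA ler_piMl ?exprn_ge0 ?invr_ge0 // exprVn.
  by rewrite ler_pdivrMr ?exprn_gt0 // mul1r -natrX ler_nat ltnW // ltn_expl.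
have -> : `|b k.+1| * (k.+1%:R * d ^+ k) =
    (`|b k.+1| * (r / 2) ^+ k.+1) / d * (k.+1%:R * 4^-1 ^+ k.+1).
  have -> : d ^+ k = (r / 2) ^+ k.+1 * 4^-1 ^+ k.+1 / d.
    by rewrite -exprMn -/d exprSr mulfK // gt_eqF.
  by ring.
rewrite ler_pM ?mulr_ge0 ?invr_ge0 ?exprn_ge0 ?invr_ge0 ?(ltW d0) //.
  by rewrite divr_ge0 // ltW.
by rewrite ler_wpM2r // invr_ge0 ltW.
Unshelve. all: by end_near.
Qed.
Lemma cvg_at_dist_leP f z l : f y @[y --> z] --> l <->
  forall e, 0 < e -> \forall y \near z, `|l - f y| <= e.
Proof. by split=> /(@cvgrPdist_le _ _ _ (nbhs z)). Qed.

Lemma near_dist_le z e : 0 < e -> \forall y \near z, `|z - y| <= e.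
Proof. by move: e; apply/(cvg_at_dist_leP id); exact: cvg_id. Qed.

Lemma cvg_series_center b : series (fun j => b j * 0 ^+ j) @ \oo --> b 0.
Proof.
apply: cvg_near_cst; exists 1%N => //= -[//|n] _.
rewrite seriesEnat /= big_nat_recl //= expr0 mulr1 big1 ?addr0 // => i _.
by rewrite expr0n mulr0.
Qed.

Lemma power_series_center f z b r : power_series_at f z b r -> f z = b 0.
Proof.
move=> [r0 /(_ z)]; rewrite subrr normr0 => /(_ r0) h.
exact: (cvg_unique _ h (@cvg_series_center b)).
Qed.

Lemma power_series_continuous f z b r :
  power_series_at f z b r -> f y @[y --> z] --> f z.
Proof.
move=> hf; have [d d0 [M M0 lip]] := power_series_tail_lipschitz hf.
have M1 : 0 < M + 1 by rewrite ltr_wpDl.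
apply/cvg_at_dist_leP => e e0; near=> y.
have := lip 0%N z y; rewrite !seriesEnat /= !big_geq // !subr0 expr0 mulr1.
rewrite subrr normr0 => /(_ (ltW d0)) h; apply: (le_trans (h _)).
  by rewrite distrC; near: y; exact: near_dist_le.
apply: (@le_trans _ _ ((M + 1) * `|z - y|)); first by rewrite ler_wpM2r // lerDl.
rewrite mulrC -ler_pdivlMr //; near: y.
by apply: near_dist_le; rewrite divr_gt0.
Unshelve. all: by end_near.
Qed.

(** Caratheodory's form of differentiability, here and in the converse below:
    with the increment factored by a continuous function, both chain rules (for
    holomorphic maps, and for a holomorphic map along a real path) reduce to
    limits of products. *)
Lemma caratheodory_is_derive f g z :
  (forall y, f y - f z = (y - z) * g y) -> g y @[y --> z] --> g z ->
  is_derive z 1 f (g z).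
Proof.
move=> fg gz.
have h : h^-1 *: (f (h *: 1 + z) - f z) @[h --> 0^'] --> g z.
  have gz' : g (h + z) @[h --> (0 : K)^'] --> g z.
    apply: (cvg_comp _ _ _ gz); apply: cvg_within_filter.
    have : h + z @[h --> (0 : K)] --> 0 + z.
      by apply: (@cvgD K K _ (nbhs (0 : K)) _ id (cst z)); [move=> A | exact: cvg_cst].
    by rewrite add0r.
  apply: cvg_trans gz'; apply: near_eq_cvg; near=> h.
  rewrite fg [h *: 1]mulr1 addrK [_ *: _]mulrA mulVf ?mul1r //.
  by near: h; exact: nbhs_dnbhs_neq.
by split; [apply/cvg_ex; exists (g z) | exact/cvg_lim].
Unshelve. all: by end_near.
Qed.

Lemma derivable_caratheodory f z : derivable f z 1 ->
  exists g, [/\ forall y, f y - f z = (y - z) * g y, g z = derive1 f z &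
    g y @[y --> z] --> g z].
Proof.
move=> df.
pose g y := if y == z then derive1 f z else (y - z)^-1 * (f y - f z).
exists g; rewrite /g eqxx; split=> // [y|].
  by case: eqVneq => [->|yz]; rewrite ?subrr ?mul0r // mulrA mulfV ?mul1r // subr_eq0.
have dq : h^-1 *: (f (h *: 1 + z) - f z) @[h --> 0^'] --> derive1 f z.
  by rewrite derive1E; exact: df.
apply/cvg_at_dist_leP => e e0.
move/cvgrPdist_le: dq => /(_ e e0); rewrite near_withinE => dq.
have sz : y - z @[y --> z] --> (0 : K).
  have : y - z @[y --> z] --> z - z.
    by apply: (@cvgB K K _ (nbhs z) _ id (cst z)); [move=> A | exact: cvg_cst].
  by rewrite subrr.
move: (sz _ dq); rewrite !nbhs_simpl /=; apply: filterS => y /= hy.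
case: eqVneq => [_|yz]; first by rewrite subrr normr0 ltW.
by have := hy; rewrite subr_eq0 => /(_ yz); rewrite [_ *: 1]mulr1 subrK.
Qed.

Lemma is_derive_comp f g z : derivable g z 1 -> derivable f (g z) 1 ->
  is_derive z 1 (f \o g) (derive1 f (g z) * derive1 g z).
Proof.
move=> dg df.
have [G [gG Gz cG]] := derivable_caratheodory dg.
have [F [fF Fz cF]] := derivable_caratheodory df.
rewrite -Fz -Gz.
apply: (@caratheodory_is_derive (f \o g) (fun y => F (g y) * G y)) => [y|].
  by rewrite /= fF gG mulrAC mulrA mulrAC.
apply: (@cvgM K K (nbhs z) _ (F \o g) G _ _ _ cG).
apply: (@cvg_comp _ _ _ g F (nbhs z) _ _ _ cF).
by move/derivable1_diffP: dg => dg; exact: (@differentiable_continuous K K K).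
Qed.

(** The difference quotients at the centre are the values of the shifted power
    series, which is continuous there. *)
Lemma power_series_is_derive f z b r : power_series_at f z b r ->
  is_derive z 1 f (b 1%N).
Proof.
move=> hf; have fz := power_series_center hf.
pose g y := if y == z then b 1%N else (f y - f z) / (y - z).
have gz : g z = b 1%N by rewrite /g eqxx.
rewrite -gz; apply: caratheodory_is_derive => [y|].
  rewrite /g; case: eqVneq => [->|yz]; first by rewrite !subrr mul0r.
  by rewrite mulrC divfK // subr_eq0.
apply: (@power_series_continuous g z (b \o S) r).
case: hf => r0 hf; split=> // y /[dup] yr /hf.
rewrite /g; case: eqVneq => [->|yz] hy.
  by rewrite subrr -[b 1%N]/((b \o S) 0%N); exact: cvg_series_center.
have : (series (fun j => b j * (y - z) ^+ j) (n + 1)%N - f z) / (y - z) @[n --> \oo] -->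
    (f y - f z) / (y - z).
  by apply: cvgMr_tmp; apply: cvgB; [rewrite (cvg_shiftn 1 (series _)) | exact: cvg_cst].
apply: cvg_trans; apply: near_eq_cvg; near=> n.
rewrite addn1 !seriesEnat /= big_nat_recl //= expr0 mulr1 fz addrC addKr.
rewrite mulr_suml; apply: eq_bigr => i _.
by rewrite exprSr mulrA mulfK // subr_eq0.
Unshelve. all: by end_near.
Qed.

Definition deriv_partial_sum b z n y := \sum_(0 <= k < n) b k * (k%:R * (y - z) ^+ k.-1).

Lemma is_derive_partial b z n y :
  is_derive y 1 (fun x => series (fun j => b j * (x - z) ^+ j) n)
    (deriv_partial_sum b z n y).
Proof.
elim: n => [|n IH].
  rewrite /deriv_partial_sum big_geq // (_ : (fun x => _) = cst 0).
    exact: is_derive_cst.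
  by apply/funext => x; rewrite seriesEnat /= big_geq.
rewrite /deriv_partial_sum big_nat_recr //= -/(deriv_partial_sum b z n y).
rewrite (_ : (fun x => _) = (fun x => series (fun j => b j * (x - z) ^+ j) n) +
   b n \*: ((fun x => x - z) ^+ n)); last first.
  by apply/funext => x; rewrite /= !seriesEnat /= big_nat_recr //= !fctE.
apply: is_deriveD; apply: is_deriveZ.
have : is_derive y 1 (fun x => x - z) (1 - 0).
  exact: (@is_deriveB _ _ _ id (cst z)).
move=> /(is_deriveX n) /is_derive_eq; apply.
by rewrite subr0 [LHS]mulr1.
Qed.

(** Away from the centre the derivative is assumed to exist; it is then
    approximated by the derivatives of the partial sums, because the difference
    quotients of the tail are bounded by its Lipschitz constant. *)
Lemma power_series_derive_tail f z b r : power_series_at f z b r ->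
  exists2 d, 0 < d & exists2 M, 0 <= M &
  forall n y, `|y - z| < d -> derivable f y 1 ->
    `|derive1 f y - deriv_partial_sum b z n y| <= M * 2^-1 ^+ n.
Proof.
move=> hf; have [d d0 [M M0 lip]] := power_series_tail_lipschitz hf.
exists d => //; exists M => // n y yd /derivableP df.
rewrite derive1E.
set l := 'D_1 f y - _.
have [/= dg gl] : is_derive y 1 (f - (fun x => series (fun j => b j * (x - z) ^+ j) n)) l.
  exact: is_deriveB df (is_derive_partial b z n y).
rewrite -gl; apply: (norm_lim_le dg).
have near_d : \forall h \near (0 : K)^', `|h *: 1 + y - z| <= d.
  have e0 : 0 < d - `|y - z| by rewrite subr_gt0.
  have := near_dist_le 0 e0; move/(@nbhs_dnbhs K 0); apply: filterS => h.
  rewrite sub0r normrN lerBrDr [h *: 1]mulr1 -addrA; apply: le_trans.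
  exact: ler_normD.
near=> h.
have hd : `|h *: 1 + y - z| <= d by near: h.
have h0 : h != 0 by near: h; exact: nbhs_dnbhs_neq.
rewrite normrZ normfV mulrC ler_pdivrMr ?normr_gt0 //.
by have := lip n _ _ hd (ltW yd); rewrite [h *: 1]mulr1 addrK; apply.
Unshelve. all: by end_near.
Qed.
End PowerSeries.

Local Open Scope complex_scope.

Section ComplexPowerSeries.
Variable R : realType.
Local Notation C := R[i].

(** This is where the archimedean property of the reals is used. *)
Lemma geometric_half_near (M e : C) : 0 <= M -> 0 < e ->
  \forall n \near \oo, M * 2^-1 ^+ n <= e.
Proof.
case: M => [M Mi]; rewrite lecE /= => /andP[/eqP -> M0].
case: e => [e ei]; rewrite ltcE /= => /andP[/eqP -> e0].
have := @cvg_geometric R M 2^-1; rewrite ger0_norm ?invr_ge0 //.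
rewrite invf_lt1 // ltr1n => /(_ isT) /cvgrPdist_le /(_ _ e0).
apply: filterS => n /=; rewrite sub0r normrN ger0_norm; last first.
  by rewrite mulr_ge0 // exprn_ge0 // invr_ge0.
have -> : (2^-1 : C) = (2^-1)%:C by rewrite fmorphV rmorph_nat.
by rewrite -!/(_%:C) -rmorphXn -rmorphM lecR.
Qed.

(** By [power_series_derive_tail] the termwise derivative of the series at [z]
    converges to the derivative: the points near [z], being centres of power
    series too, provide the differentiability which that lemma assumes. *)
Lemma analytic_at_derive1 (f : C -> C) (z : C) :
  (\forall y \near (z : C^o), analytic_at f y) -> analytic_at (derive1 (f : C -> C^o)) z.
Proof.
move=> /[dup] /nbhs_singleton[b [r hf]] hnear.
have [d d0 [M M0 tl]] := power_series_derive_tail hf.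
have /nbhs_ballP[e /= e0 he] :
    \forall y \near (z : C^o), analytic_at f y /\ `|z - y| <= d / 2.
  by apply: filterI => //; apply: near_dist_le; rewrite divr_gt0.
exists (fun j => b j.+1 * j.+1%:R), e; split=> // y ye.
have [[c [r' hy]] yd] : analytic_at f y /\ `|z - y| <= d / 2.
  by apply: he; rewrite -ball_normE /= distrC.
have {}yd : `|y - z| < d.
  by rewrite distrC (le_lt_trans yd) // ltr_pdivrMr // ltr_pMr // ltr1n.
have dy : derivable (f : C^o -> C^o) y 1 by case: (power_series_is_derive hy).
apply/cvgrPdist_le => eps eps0.
have [N _ HN] := geometric_half_near M0 eps0.
exists N => // n /= Nn.
have /HN /= : (N <= n.+1)%N by exact: leqW.
apply: le_trans; have := tl n.+1 y yd dy.
rewrite /deriv_partial_sum big_nat_recl //= mul0r mulr0 add0r.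
rewrite (_ : series _ n = \sum_(0 <= i < n) b i.+1 * (i.+1%:R * (y - z) ^+ i)) //.
by rewrite seriesEnat; apply: eq_bigr => i _; rewrite mulrA.
Qed.

(** A Laurent series without principal part, reindexed from [0]. *)
Lemma holomorphic_analytic (f : C -> C) (z : C) : holomorphic_at f z -> analytic_at f z.
Proof.
move=> [a [[m [am [r r0 h]]] a0 fz]].
exists (fun j => a j%:Z), r; split => // y yr.
have [->|yz] := eqVneq y z.
  by rewrite subrr fz; exact: (@cvg_series_center C (fun j => a j%:Z)).
have := h y; rewrite yr andbT normr_gt0 subr_eq0 => /(_ yz).
(* The Laurent sums start at the index -m, so m more of their terms are taken. *)
rewrite -(@cvg_shiftn m C^o (series (fun j => a (_ - _) * _))).
apply: cvg_trans; apply: near_eq_cvg.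
near=> n; rewrite /= !seriesEnat /=.
rewrite (@big_cat_nat _ _ _ m) //= ?leq_addl //.
rewrite big_nat_cond big1 ?add0r => [|i /andP[/andP[_ im] _]]; last first.
  by rewrite a0 ?mul0r // subr_lt0.
rewrite -{1}[m]add0n big_addn addnK; apply: eq_bigr => i _.
by rewrite PoszD addrK.
Unshelve. all: by end_near.
Qed.
End ComplexPowerSeries.

(** * Calculus of one complex variable *)

Section ComplexDerivative.
Variable R : realType.
Local Notation C := R[i].
Implicit Types (F G : C -> C) (z : C).

Definition cderivable F z := derivable (F : C^o -> C^o) z 1.

Lemma cderiv_is_derive F z : cderivable F z ->
  is_derive (z : C^o) 1 (F : C^o -> C^o) (cderiv F z).
Proof. by move=> /derivableP; rewrite /cderiv derive1E. Qed.

Lemma is_derive_cderiv F z (l : C) :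
  is_derive (z : C^o) 1 (F : C^o -> C^o) l -> cderivable F z /\ cderiv F z = l.
Proof. by move=> [dF Fl]; split; [exact: dF | rewrite /cderiv derive1E; exact: Fl]. Qed.

Lemma cderivD F G z : cderivable F z -> cderivable G z ->
  cderivable (fun y => F y + G y) z /\
  cderiv (fun y => F y + G y) z = cderiv F z + cderiv G z.
Proof.
move=> /cderiv_is_derive dF /cderiv_is_derive dG.
exact: is_derive_cderiv (is_deriveD dF dG).
Qed.

Lemma cderivN F z : cderivable F z ->
  cderivable (fun y => - F y) z /\ cderiv (fun y => - F y) z = - cderiv F z.
Proof.
by move=> /cderiv_is_derive dF; exact: is_derive_cderiv (is_deriveN dF).
Qed.

Lemma cderivM F G z : cderivable F z -> cderivable G z ->
  cderivable (fun y => F y * G y) z /\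
  cderiv (fun y => F y * G y) z = cderiv F z * G z + F z * cderiv G z.
Proof.
move=> /cderiv_is_derive dF /cderiv_is_derive dG; apply: is_derive_cderiv.
by apply: is_derive_eq (is_deriveM dF dG) _; rewrite addrC; congr (_ + _); rewrite mulrC.
Qed.

Lemma cderiv_cst (a : C) z : cderivable (fun=> a) z /\ cderiv (fun=> a) z = 0.
Proof. by apply: is_derive_cderiv; exact: (@is_derive_cst C C^o C^o). Qed.

Lemma near_eq_cderiv F G z : (\forall y \near (z : C^o), F y = G y) ->
  cderivable F z -> cderivable G z /\ cderiv G z = cderiv F z.
Proof.
move=> FG /cderiv_is_derive dF; apply: is_derive_cderiv.
exact: (@near_eq_is_derive C C^o C^o _ _ _ _ _ FG dF).
Qed.

Lemma cderivable_continuous F z : cderivable F z ->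
  F y @[y --> (z : C^o)] --> (F z : C^o).
Proof.
move=> /derivable1_diffP dF; exact: (@differentiable_continuous C C^o C^o).
Qed.

Lemma cderiv_comp F G z : cderivable G z -> cderivable F (G z) ->
  cderivable (F \o G) z /\ cderiv (F \o G) z = cderiv F (G z) * cderiv G z.
Proof.
move=> dG dF.
exact: is_derive_cderiv (is_derive_comp dG dF).
Qed.

Lemma near_eq_cvg_at F G z (l : C) : (\forall y \near (z : C^o), F y = G y) ->
  F y @[y --> (z : C^o)] --> (l : C^o) -> G y @[y --> (z : C^o)] --> (l : C^o).
Proof. by move=> FG; apply: cvg_trans; exact: (@near_eq_cvg C C (nbhs (z : C^o)) _). Qed.

Lemma cvg_atD F G z (a b : C) :
  F y @[y --> (z : C^o)] --> (a : C^o) -> G y @[y --> (z : C^o)] --> (b : C^o) ->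
  F y + G y @[y --> (z : C^o)] --> (a + b : C^o).
Proof. exact: (@cvgD C C^o _ (nbhs (z : C^o)) _ F G). Qed.

Lemma cvg_atM F G z (a b : C) :
  F y @[y --> (z : C^o)] --> (a : C^o) -> G y @[y --> (z : C^o)] --> (b : C^o) ->
  F y * G y @[y --> (z : C^o)] --> (a * b : C^o).
Proof. exact: (@cvgM C C^o (nbhs (z : C^o)) _ F G). Qed.

(** The regularity kept track of for functions built from holomorphic ones:
    unlike a power series expansion, it passes to products without any
    multiplication of series. *)
Definition C1_at F z :=
  (\forall y \near (z : C^o), cderivable F y) /\
  cderiv F y @[y --> (z : C^o)] --> (cderiv F z : C^o).

Lemma C1_at_derivable F z : C1_at F z -> cderivable F z.
Proof. by move=> [/nbhs_singleton]. Qed.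

Lemma C1_at_continuous F z : C1_at F z -> F y @[y --> (z : C^o)] --> (F z : C^o).
Proof. by move=> /C1_at_derivable /cderivable_continuous. Qed.

Lemma near_eq_C1_at F G z :
  (\forall y \near (z : C^o), F y = G y) -> C1_at F z -> C1_at G z.
Proof.
move=> FG [dF cF].
have FG' : \forall y \near (z : C^o), \forall x \near (y : C^o), F x = G x.
  exact: (@near_join C^o).
split.
  by apply: filterS2 FG' dF => y FGy /(near_eq_cderiv FGy)[].
rewrite (near_eq_cderiv FG (nbhs_singleton dF)).2.
apply: near_eq_cvg_at cF.
by apply: filterS2 FG' dF => y FGy /(near_eq_cderiv FGy)[_ ->].
Qed.

Lemma C1_atD F G z : C1_at F z -> C1_at G z -> C1_at (fun y => F y + G y) z.
Proof.
move=> F1 G1; have [dF cF] := F1; have [dG cG] := G1; split.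
  by apply: filterS2 dF dG => y dFy /(cderivD dFy)[].
rewrite (cderivD (C1_at_derivable F1) (C1_at_derivable G1)).2.
apply: near_eq_cvg_at (cvg_atD cF cG).
by apply: filterS2 dF dG => y dFy /(cderivD dFy)[_ ->].
Qed.

Lemma C1_atN F z : C1_at F z -> C1_at (fun y => - F y) z.
Proof.
move=> F1; have [dF cF] := F1; split.
  by apply: filterS dF => y /cderivN[].
rewrite (cderivN (C1_at_derivable F1)).2.
apply: near_eq_cvg_at (@cvgN C C^o _ (nbhs (z : C^o)) _ _ _ cF).
by apply: filterS dF => y /cderivN[_ ->].
Qed.

Lemma C1_atM F G z : C1_at F z -> C1_at G z -> C1_at (fun y => F y * G y) z.
Proof.
move=> F1 G1; have [dF cF] := F1; have [dG cG] := G1; split.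
  by apply: filterS2 dF dG => y dFy /(cderivM dFy)[].
rewrite (cderivM (C1_at_derivable F1) (C1_at_derivable G1)).2.
apply: near_eq_cvg_at 
  (cvg_atD (cvg_atM cF (C1_at_continuous G1)) (cvg_atM (C1_at_continuous F1) cG)).
by apply: filterS2 dF dG => y dFy /(cderivM dFy)[_ ->].
Qed.

Lemma C1_at_cst (a : C) z : C1_at (fun=> a) z.
Proof.
split; first exact: (@filterE _ (nbhs (z : C^o)) _ _ (fun y => (cderiv_cst a y).1)).
rewrite (_ : cderiv _ = fun=> 0); first exact: (@cvg_cst C^o _ _ (nbhs (z : C^o)) _).
by apply/funext => y; exact: (cderiv_cst a y).2.
Qed.

Lemma analytic_C1_at F z : (\forall y \near (z : C^o), analytic_at F y) -> C1_at F z.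
Proof.
move=> aF; split; first by apply: filterS aF => y [b [r /power_series_is_derive[]]].
have [b [r /power_series_is_derive[/= dF _]]] := analytic_at_derive1 aF.
exact: (@cderivable_continuous (cderiv F)).
Qed.

(** The second conclusion is needed since the derivative of a Lax operator is
    itself differentiated when the connection is applied twice. *)
Lemma holomorphic_C1_at F z :
  (\forall y \near (z : C^o), holomorphic_at F y) -> C1_at F z /\ C1_at (cderiv F) z.
Proof.
move=> hF.
have aF : \forall y \near (z : C^o), analytic_at F y.
  by apply: filterS hF => y; exact: holomorphic_analytic.
split; first exact: analytic_C1_at.
apply: analytic_C1_at.
have : \forall y \near (z : C^o), \forall x \near (y : C^o), analytic_at F x.
  exact: (@near_join C^o).
by apply: filterS => y ay; exact: (analytic_at_derive1 ay).
Qed.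

Lemma holomorphic_cderivable F z : holomorphic_at F z -> cderivable F z.
Proof. by move=> /holomorphic_analytic[b [r /power_series_is_derive[]]]. Qed.

End ComplexDerivative.

Lemma cderiv_sum (R : realType) (I : Type) (r : seq I) (F : I -> R[i] -> R[i]) z :
  (forall i, cderivable (F i) z) ->
  cderivable (fun y => \sum_(i <- r) F i y) z /\
  cderiv (fun y => \sum_(i <- r) F i y) z = \sum_(i <- r) cderiv (F i) z.
Proof.
move=> dF; elim: r => [|i r [IH1 IH2]].
  rewrite big_nil (_ : (fun y => _) = fun=> 0); first exact: cderiv_cst.
  by apply/funext => y; rewrite big_nil.
rewrite big_cons -IH2 (_ : (fun y => _) = fun y => F i y + \sum_(i <- r) F i y).
  exact: (cderivD (dF i) IH1).
by apply/funext => y; rewrite big_cons.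
Qed.

Lemma C1_at_sum (R : realType) (I : Type) (r : seq I) (F : I -> R[i] -> R[i]) z :
  (forall i, C1_at (F i) z) -> C1_at (fun y => \sum_(i <- r) F i y) z.
Proof.
move=> F1; elim: r => [|i r IH].
  rewrite (_ : (fun y => _) = fun=> 0); first exact: C1_at_cst.
  by apply/funext => y; rewrite big_nil.
rewrite (_ : (fun y => _) = fun y => F i y + \sum_(i <- r) F i y).
  exact: (C1_atD (F1 i) IH).
by apply/funext => y; rewrite big_cons.
Qed.

(** * Complex-valued paths *)

Section ComplexPaths.
Variable R : realType.
Local Notation C := R[i].
Local Notation Re := (@complex.Re R).
Local Notation Im := (@complex.Im R).

Lemma ReM (x y : C) : Re (x * y) = Re x * Re y - Im x * Im y.
Proof. by case: x => ? ?; case: y. Qed.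

Lemma ImM (x y : C) : Im (x * y) = Re x * Im y + Im x * Re y.
Proof. by case: x => ? ?; case: y. Qed.

Lemma ReB (x y : C) : Re (x - y) = Re x - Re y.
Proof. by case: x => ? ?; case: y. Qed.

Lemma ImB (x y : C) : Im (x - y) = Im x - Im y.
Proof. by case: x => ? ?; case: y. Qed.

Lemma normc_ge_Im (x : C) : `|Im x|%:C <= `|x|.
Proof.
have := normc_ge_Re (x * 'i); rewrite ReiNIm normrN normrM; congr (_ <= _).
by rewrite [`|'i|]normc_def /= expr0n expr1n add0r sqrtr1 mulr1.
Qed.

Lemma normc_le_Re_Im (x : C) : `|x| <= (`|Re x| + `|Im x|)%:C.
Proof.
rewrite {1}[x]complexE (le_trans (ler_normD _ _)) // rmorphD /=.
have normR (a : R) : `|a%:C| = `|a|%:C :> C.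
  by rewrite normc_def /= expr0n addr0 sqrtr_sqr.
rewrite lerD ?normR // normrM [`|'i|]normc_def /= expr0n expr1n add0r sqrtr1.
by rewrite mul1r normR.
Qed.

Lemma cvg_complexP (T : Type) (F : set_system T) (FF : Filter F) (p : T -> C) (l : C) :
  p @ F --> (l : C^o) <-> (Re \o p @ F --> Re l /\ Im \o p @ F --> Im l).
Proof.
split=> [/(@cvgrPdist_le C C^o _ F) pl|[/cvgrPdist_le pr /cvgrPdist_le pi]].
  split; apply/cvgrPdist_le => e e0.
    have := pl e%:C; rewrite ltcR => /(_ e0); apply: filterS => t /= h.
    by rewrite -lecR -ReB (le_trans _ h) // normc_ge_Re.
  have := pl e%:C; rewrite ltcR => /(_ e0); apply: filterS => t /= h.
  by rewrite -lecR -ImB (le_trans _ h) // normc_ge_Im.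
apply/(@cvgrPdist_le C C^o _ F) => -[e ei]; rewrite ltcE /= => /andP[/eqP -> e0].
have e2 : 0 < e / 2 by rewrite divr_gt0.
apply: filterS2 (pr _ e2) (pi _ e2) => t /= ht hi.
rewrite (le_trans (normc_le_Re_Im _)) // lecR ReB ImB.
by rewrite [leRHS]splitr lerD.
Qed.

(** Componentwise, as [velocity] is. *)
Definition path_derive (p : R -> C) (t : R) (l : C) :=
  is_derive t 1 (Re \o p) (Re l) /\ is_derive t 1 (Im \o p) (Im l).

Lemma is_derive_continuous (f : R -> R) (t l : R) : is_derive t 1 f l ->
  f v @[v --> t] --> f t.
Proof.
move=> [/derivable1_diffP df _]; exact: differentiable_continuous.
Qed.

Lemma path_derive_continuous p t l : path_derive p t l ->
  p v @[v --> t] --> (p t : C^o).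
Proof.
by move=> [/is_derive_continuous pr /is_derive_continuous pi]; apply/cvg_complexP.
Qed.

Lemma near_eq_path_derive p q t l : (\forall v \near t, p v = q v) ->
  path_derive p t l -> path_derive q t l.
Proof.
move=> pq [pr pi]; split; [apply: near_eq_is_derive pr | apply: near_eq_is_derive pi];
  by apply: filterS pq => v /= ->.
Qed.

(** The chain rule for a holomorphic function along a path: the increments of [F]
    and of both components of [p] are factored by [derivable_caratheodory], and
    the product of the cofactors is continuous at [t]. *)
Lemma path_derive_comp (F : C -> C) p t l : path_derive p t l -> cderivable F (p t) ->
  path_derive (F \o p) t (cderiv F (p t) * l).
Proof.
move=> pl dF; have cp := path_derive_continuous pl; case: pl => pr pi.
have [G [FG Gz cG]] := derivable_caratheodory dF.
have [[dr er] [di ei]] := (pr, pi).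
have [a [Ha at_ ca]] := derivable_caratheodory dr.
have [b [Hb bt cb]] := derivable_caratheodory di.
have at' : a t = Re l by rewrite at_ derive1E.
have bt' : b t = Im l by rewrite bt derive1E.
pose H v := G (p v) * (a v +i* b v).
have Ht : H t = cderiv F (p t) * l by rewrite /H Gz at' bt'; case: (l).
have cH : H v @[v --> t] --> (H t : C^o).
  apply: (@cvgM C R (nbhs t) _ (G \o p)); first exact: (cvg_comp _ _ cp cG).
  by apply/cvg_complexP.
have FH v : F (p v) - F (p t) = (v - t)%:C * H v.
  rewrite FG /H mulrCA mulrC; congr (_ * _).
  have /= Hav := Ha v; have /= Hbv := Hb v.
  by apply/eqP; rewrite eq_complex ReM ImM ReB ImB /= Hav Hbv !mul0r subr0 addr0 !eqxx.
have /cvg_complexP[cr ci] := cH.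
rewrite -Ht; split.
  apply: (@caratheodory_is_derive R _ (Re \o H)) => // v.
  by rewrite /= -ReB FH ReM /= mul0r subr0.
apply: (@caratheodory_is_derive R _ (Im \o H)) => // v.
by rewrite /= -ImB FH ImM /= mul0r addr0.
Qed.

Definition path_int (h : R -> C) : C :=
  Rintegral lebesgue_measure `[0, 1] (Re \o h) +i*
  Rintegral lebesgue_measure `[0, 1] (Im \o h).

Definition continuous_on_01 (h : R -> C) :=
  {within `[0 : R, 1], continuous (Re \o h)} /\
  {within `[0 : R, 1], continuous (Im \o h)}.

Lemma eq_path_int h k : (forall t : R, 0 <= t <= 1 -> h t = k t) ->
  path_int h = path_int k.
Proof.
move=> hk; rewrite /path_int; congr (_ +i* _); apply: eq_Rintegral => t;
  by rewrite inE /= in_itv /= => /hk ->.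
Qed.

Lemma path_intD h k : continuous_on_01 h -> continuous_on_01 k ->
  path_int (fun t => h t + k t) = path_int h + path_int k.
Proof.
move=> [hr hi] [kr ki].
have itg f : {within `[0 : R, 1], continuous f} ->
    (@lebesgue_measure R).-integrable `[0, 1] (EFin \o f).
  by move=> cf; apply: continuous_compact_integrable => //; exact: segment_compact.
have -> : path_int h + path_int k =
  (Rintegral lebesgue_measure `[0, 1] (Re \o h) +
   Rintegral lebesgue_measure `[0, 1] (Re \o k)) +i*
  (Rintegral lebesgue_measure `[0, 1] (Im \o h) +
   Rintegral lebesgue_measure `[0, 1] (Im \o k)) by [].
rewrite -!RintegralD //; try exact: itg.
by congr (_ +i* _); apply: eq_Rintegral => t _ /=; case: (h t) => ? ?; case: (k t).
Qed.

Lemma Rintegral_is_derive (F f : R -> R) : {within `[0 : R, 1], continuous f} ->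
  (forall t : R, 0 <= t <= 1 -> is_derive t 1 F (f t)) ->
  Rintegral lebesgue_measure `[0, 1] f = F 1 - F 0.
Proof.
move=> cf dF; rewrite /Rintegral (@continuous_FTC2 _ f F) //=.
- split=> [t||].
  + by rewrite in_itv /= => /andP[t0 t1]; have [] := dF t; rewrite ?ltW.
  + apply: cvg_at_right_filter; apply: is_derive_continuous (dF 0 _).
    by rewrite lexx ler01.
  + apply: cvg_at_left_filter; apply: is_derive_continuous (dF 1 _).
    by rewrite lexx ler01.
- move=> t; rewrite in_itv /= => /andP[t0 t1].
  have t01 : 0 <= t <= 1 by rewrite !ltW.
  by rewrite derive1E; case: (dF t t01).
Qed.

Lemma path_int_derive (p h : R -> C) : continuous_on_01 h ->
  (forall t : R, 0 <= t <= 1 -> path_derive p t (h t)) -> path_int h = p 1 - p 0.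
Proof.
move=> [hr hi] dp; rewrite /path_int.
rewrite (Rintegral_is_derive hr (fun t ht => (dp t ht).1)).
rewrite (Rintegral_is_derive hi (fun t ht => (dp t ht).2)) /=.
by case: (p 1) => ? ?; case: (p 0).
Qed.

End ComplexPaths.

Lemma path_derive_unique (R : realType) (q : R -> R[i]) t l : path_derive q t l ->
  derive1 (fun v => complex.Re (q v)) t +i* derive1 (fun v => complex.Im (q v)) t = l.
Proof. by move=> [[_ er] [_ ei]]; rewrite !derive1E er ei; case: (l). Qed.

(** * Functions, forms and curves on a Riemann surface *)

Section Surface.
Variables (R : realType) (X : riemann_surface R).
Local Notation C := R[i].
Local Notation chartX := (chart R X).
Implicit Types (c : chartX) (x : X) (F G w : chartX -> X -> C) (f : X -> C).

Lemma chart_at_atlas x : atlas (chart_at x).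
Proof. exact: (s2valP (cid2 (atlas_cover x))). Qed.

Lemma chart_at_cdom x : cdom (chart_at x) x.
Proof. exact: (s2valP' (cid2 (atlas_cover x))). Qed.

Lemma chart_cinvK c x : cdom c x -> cinv c (cmap c x) = x.
Proof. by move=> cx; apply: (@cmapK _ _ c); rewrite inE. Qed.

(** Transports a property of the points near [x] to the coordinate, together with
    the facts that make [cmap] and [cinv] inverse to each other there. *)
Lemma chart_near c x (P : set X) : cdom c x -> (\forall y \near x, P y) ->
  \forall z \near (cmap c x : C^o),
    [/\ P (cinv c z), cdom c (cinv c z) & cmap c (cinv c z) = z].
Proof.
move=> cx nP.
have ix : (cmap c @` cdom c) (cmap c x) by exists x.
have nP' : \forall z \near (cmap c x : C^o), P (cinv c z).
  by apply: (cinv_cont ix); rewrite (chart_cinvK cx).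
have ni : \forall z \near (cmap c x : C^o), (cmap c @` cdom c) z.
  exact: (open_nbhs_nbhs (conj (@cimg_open _ _ c) ix)).
apply: filterS2 nP' ni => z Pz [y cy yz].
by split=> //; rewrite -yz chart_cinvK.
Qed.

Lemma transition_derivable c c' x : atlas c -> atlas c' -> cdom c x -> cdom c' x ->
  cderivable (transition c c') (cmap c x).
Proof.
move=> ac ac' cx cx'; apply: holomorphic_cderivable.
by have [] := atlas_compatible ac ac' cx cx'.
Qed.

Section OpenSet.
Variables (A : set X) (oA : open A).

(** [F] is a family of coefficients, one for each chart; a function on the surface
    is the constant family [fun=> f]. *)
Definition C1_in_charts F := forall c x, atlas c -> cdom c x -> A x ->
  C1_at (F c \o cinv c) (cmap c x).

(** The transformation rule is only required on [A], the complement of the poles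
    in the application: at a pole the values of a function, hence those of a form
    computed from it, are arbitrary. *)
Definition continuous_form w :=
  (forall c c' x, atlas c -> atlas c' -> cdom c x -> cdom c' x -> A x ->
    w c x = cderiv (transition c c') (cmap c x) * w c' x) /\
  (forall c x, atlas c -> cdom c x -> A x ->
    w c (cinv c z) @[z --> (cmap c x : C^o)] --> (w c x : C^o)).

Lemma near_open x : A x -> \forall y \near x, A y.
Proof. by move=> Ax; exact: open_nbhs_nbhs. Qed.

Lemma eq_C1_in_charts F G :
  (forall c x, atlas c -> cdom c x -> A x -> F c x = G c x) ->
  C1_in_charts F -> C1_in_charts G.
Proof.
move=> FG F1 c x ac cx Ax; apply: near_eq_C1_at (F1 c x ac cx Ax).
by apply: filterS (chart_near cx (near_open Ax)) => z [Az cz _]; exact: FG.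
Qed.

Lemma hol_near F c x : (forall y, A y -> hol_at F y) -> atlas c -> cdom c x -> A x ->
  \forall z \near (cmap c x : C^o), holomorphic_at (F c \o cinv c) z.
Proof.
move=> hF ac cx Ax; apply: filterS (chart_near cx (near_open Ax)) => z [Az cz zK].
by rewrite -zK; exact: hF.
Qed.

Lemma hol_C1_in_charts F : (forall x, A x -> hol_at F x) -> C1_in_charts F.
Proof.
by move=> hF c x ac cx Ax; have [] := holomorphic_C1_at (hol_near hF ac cx Ax).
Qed.

Lemma hol_C1_fun_d f : (forall x, A x -> hol_at (fun=> f) x) -> C1_in_charts (fun_d f).
Proof.
move=> hf c x ac cx Ax.
have [_] := holomorphic_C1_at (hol_near hf ac cx Ax); apply: near_eq_C1_at.
by apply: filterS (chart_near cx (near_open Ax)) => z [_ _ zK]; rewrite /fun_d /= zK.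
Qed.

(** The transformation rule is the chain rule applied to
    [f \o cinv c = (f \o cinv c') \o transition c c'] near [cmap c x]. *)
Lemma fun_d_continuous_form f : C1_in_charts (fun=> f) -> continuous_form (fun_d f).
Proof.
move=> f1; split=> [c c' x ac ac' cx cx' Ax|c x ac cx Ax].
  have Tx : transition c c' (cmap c x) = cmap c' x by rewrite /transition /= chart_cinvK.
  have dT := transition_derivable ac ac' cx cx'.
  have df : cderivable (f \o cinv c') (transition c c' (cmap c x)).
    by rewrite Tx; exact: C1_at_derivable (f1 c' x ac' cx' Ax).
  have [dfT eT] := cderiv_comp dT df.
  rewrite /fun_d -Tx mulrC -eT; apply: (near_eq_cderiv _ dfT).2.
  have nc' : \forall y \near x, cdom c' y.
    exact: open_nbhs_nbhs (conj (@cdom_open _ _ c') cx').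
  apply: filterS (chart_near cx nc') => z [cz' _ _].
  by rewrite /transition /= chart_cinvK.
have [_] := f1 c x ac cx Ax; apply: near_eq_cvg_at.
by apply: filterS (chart_near cx (near_open Ax)) => z [_ _ zK]; rewrite /fun_d /= zK.
Qed.

Lemma continuous_formD w1 w2 : continuous_form w1 -> continuous_form w2 ->
  continuous_form (fun c x => w1 c x + w2 c x).
Proof.
move=> [t1 k1] [t2 k2]; split=> [c c' x ac ac' cx cx' Ax|c x ac cx Ax].
  by rewrite (t1 c c') // (t2 c c') // mulrDr.
exact: cvg_atD (k1 c x ac cx Ax) (k2 c x ac cx Ax).
Qed.

Lemma continuous_formM f w : C1_in_charts (fun=> f) -> continuous_form w ->
  continuous_form (fun c x => f x * w c x).
Proof.
move=> f1 [t k]; split=> [c c' x ac ac' cx cx' Ax|c x ac cx Ax].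
  by rewrite (t c c') // mulrCA.
rewrite -{2}(chart_cinvK cx).
exact: cvg_atM (C1_at_continuous (f1 c x ac cx Ax)) (k c x ac cx Ax).
Qed.

Lemma continuous_form0 : continuous_form (fun _ _ => 0).
Proof.
split=> [*|c x *]; first by rewrite mulr0.
exact: (@cvg_cst C^o _ _ (nbhs (cmap c x : C^o)) _).
Qed.

Lemma continuous_form_sum (I : Type) (r : seq I) (w : I -> chartX -> X -> C) :
  (forall i, continuous_form (w i)) ->
  continuous_form (fun c x => \sum_(i <- r) w i c x).
Proof.
move=> wi; elim: r => [|i r IH].
  rewrite (_ : (fun c x => _) = fun _ _ => 0); first exact: continuous_form0.
  by apply/funext => c; apply/funext => x; rewrite big_nil.
rewrite (_ : (fun c x => _) = fun c x => w i c x + \sum_(i <- r) w i c x).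
  exact: (continuous_formD (wi i) IH).
by apply/funext => c; apply/funext => x; rewrite big_cons.
Qed.

Section Curve.
Variables (p : R -> X).
Hypothesis p1 : C1_curve p.

Lemma curve_near t (P : set X) : 0 <= t <= 1 -> (\forall y \near p t, P y) ->
  \forall v \near t, P (p v).
Proof. by move=> /p1[cp _] nP; exact: cp. Qed.

Lemma curve_near_cdom c t : 0 <= t <= 1 -> cdom c (p t) ->
  \forall v \near t, cdom c (p v).
Proof.
move=> t01 ct; apply: curve_near t01 _.
exact: open_nbhs_nbhs (conj (@cdom_open _ _ c) ct).
Qed.

Lemma curve_path_derive c t : 0 <= t <= 1 -> atlas c -> cdom c (p t) ->
  path_derive (cmap c \o p) t (velocity p c t).
Proof.
move=> /p1[_ h] ac ct; have [/nbhs_singleton dr /nbhs_singleton di _ _] := h c ac ct.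
by split; rewrite /velocity /= derive1E; exact: derivableP.
Qed.

Lemma velocity_transition c c' t : 0 <= t <= 1 -> atlas c -> atlas c' ->
  cdom c (p t) -> cdom c' (p t) ->
  velocity p c' t = cderiv (transition c c') (cmap c (p t)) * velocity p c t.
Proof.
move=> t01 ac ac' ct ct'.
have dT := transition_derivable ac ac' ct ct'.
apply: (@path_derive_unique _ (cmap c' \o p)).
apply: near_eq_path_derive (path_derive_comp (curve_path_derive t01 ac ct) dT).
apply: filterS (curve_near_cdom t01 ct) => v cv.
by rewrite /transition /= chart_cinvK.
Qed.

Hypothesis pA : forall t : R, 0 <= t <= 1 -> A (p t).

Definition pullback w (t : R) : C :=
  w (chart_at (p t)) (p t) * velocity p (chart_at (p t)) t.

Lemma curve_int_pullback w : curve_int p w = path_int (pullback w).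
Proof. by []. Qed.

(** The chart [chart_at (p t)] jumps with [t]; this frees the integrand from it, so
    that near each time it can be computed in one fixed chart. *)
Lemma pullback_chart w c t :
  continuous_form w -> 0 <= t <= 1 -> atlas c -> cdom c (p t) ->
  pullback w t = w c (p t) * velocity p c t.
Proof.
move=> [tw _] t01 ac ct; rewrite /pullback; set c' := chart_at (p t).
have ac' : atlas c' by exact: chart_at_atlas.
have ct' : cdom c' (p t) by exact: chart_at_cdom.
rewrite (velocity_transition t01 ac ac' ct ct') (tw c c' _ ac ac' ct ct' (pA t01)).
by rewrite mulrCA mulrA.
Qed.

Lemma pullback_continuous w : continuous_form w -> continuous_on_01 (pullback w).
Proof.
move=> cw.
have h (t : R) : 0 <= t <= 1 ->
    pullback w @ within `[0, 1] (nbhs t) --> (pullback w t : C^o).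
  move=> t01; set c := chart_at (p t).
  have ac : atlas c by exact: chart_at_atlas.
  have ct : cdom c (p t) by exact: chart_at_cdom.
  rewrite (pullback_chart cw t01 ac ct).
  have k : w c (p v) * velocity p c v @[v --> t] -->
      (w c (p t) * velocity p c t : C^o).
    apply: (@cvgM C R (nbhs t) _ (fun v => w c (p v))).
      have cp := path_derive_continuous (curve_path_derive t01 ac ct).
      have [_ /(_ c (p t) ac ct (pA t01)) kw] := cw.
      have := cvg_comp _ _ cp kw; apply: cvg_trans; apply: near_eq_cvg.
      apply: filterS (curve_near_cdom t01 ct) => v cv.
      by rewrite /= chart_cinvK.
    have [_ /(_ c ac ct)[_ _ cr ci]] := p1 t01.
    exact/cvg_complexP.
  move/(@cvg_within_filter _ _ _ (nbhs t) _ _ `[0 : R, 1]): k; apply: cvg_trans.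
  apply: near_eq_cvg.
  rewrite near_withinE; apply: filterS (curve_near_cdom t01 ct) => v cv.
  by rewrite /= in_itv /= => v01; rewrite (pullback_chart cw v01 ac cv).
split; apply/subspace_continuousP => t; rewrite /= in_itv /= => /h /cvg_complexP[] //.
Qed.

Lemma curve_intD w1 w2 : continuous_form w1 -> continuous_form w2 ->
  curve_int p (fun c x => w1 c x + w2 c x) = curve_int p w1 + curve_int p w2.
Proof.
move=> c1 c2; rewrite !curve_int_pullback -path_intD; try exact: pullback_continuous.
by apply: eq_path_int => t _; rewrite /pullback mulrDl.
Qed.

Lemma eq_curve_int w1 w2 :
  (forall c x, atlas c -> cdom c x -> A x -> w1 c x = w2 c x) ->
  curve_int p w1 = curve_int p w2.
Proof.
move=> w12; rewrite !curve_int_pullback; apply: eq_path_int => t t01.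
by rewrite /pullback w12; [|exact: chart_at_atlas|exact: chart_at_cdom|exact: pA].
Qed.

(** The fundamental theorem of calculus for [f \o p], whose derivative is the
    integrand in any chart. *)
Lemma curve_int_fun_d f : C1_in_charts (fun=> f) ->
  curve_int p (fun_d f) = f (p 1) - f (p 0).
Proof.
move=> f1; rewrite curve_int_pullback; apply: (@path_int_derive _ (f \o p)).
  exact: pullback_continuous (fun_d_continuous_form f1).
move=> t t01; rewrite /pullback; set c := chart_at (p t).
have ac : atlas c by exact: chart_at_atlas.
have ct : cdom c (p t) by exact: chart_at_cdom.
have df : cderivable (f \o cinv c) ((cmap c \o p) t).
  exact: C1_at_derivable (f1 c (p t) ac ct (pA t01)).
apply: near_eq_path_derive (path_derive_comp (curve_path_derive t01 ac ct) df).
by apply: filterS (curve_near_cdom t01 ct) => v cv; rewrite /= chart_cinvK.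
Qed.

End Curve.
End OpenSet.
End Surface.

(** * Integration over cycles *)

Section Chains.
Variables (R : realType) (X : riemann_surface R) (A : set X).
Local Notation C := R[i].
Local Notation chartX := (chart R X).
Implicit Types (s : chain X) (w : chartX -> X -> C) (f : X -> C).

Definition C1_chain_in s :=
  forall p, in_chain s p -> C1_curve p /\ forall t : R, 0 <= t <= 1 -> A (p t).

Lemma eq_sum_chain s (F G : (R -> X) -> C) : (forall p, in_chain s p -> F p = G p) ->
  \sum_(mp <- s) mp.1%:~R * F mp.2 = \sum_(mp <- s) mp.1%:~R * G mp.2.
Proof.
elim: s => [|[m p] s IH] FG; first by rewrite !big_nil.
rewrite !big_cons /= FG; last by exists m; left.
by congr (_ + _); apply: IH => q [k qs]; apply: FG; exists k; right.
Qed.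

Lemma chain_intD s w1 w2 : C1_chain_in s ->
  continuous_form A w1 -> continuous_form A w2 ->
  chain_int s (fun c x => w1 c x + w2 c x) = chain_int s w1 + chain_int s w2.
Proof.
move=> sA c1 c2; rewrite /chain_int -big_split /=.
rewrite (eq_sum_chain (F := fun p => curve_int p (fun c x => w1 c x + w2 c x))
  (G := fun p => curve_int p w1 + curve_int p w2)) => [|p /sA[p1 pA]].
  by apply: eq_bigr => mp _; rewrite mulrDr.
exact: curve_intD p1 pA _ _ c1 c2.
Qed.

Lemma eq_chain_int s w1 w2 : C1_chain_in s ->
  (forall c x, atlas c -> cdom c x -> A x -> w1 c x = w2 c x) ->
  chain_int s w1 = chain_int s w2.
Proof.
move=> sA w12; apply: (eq_sum_chain (F := fun p => curve_int p w1)
  (G := fun p => curve_int p w2)) => p /sA[p1 pA].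
exact: eq_curve_int pA _ _ w12.
Qed.

(** A linear functional of the boundary: on the finite set of end points, [f] is a
    linear combination of the indicator functions of points, for which the sum
    vanishes by hypothesis. *)
Lemma sum_boundary s f :
  (forall x : X, \sum_(mp <- s) mp.1 * ((mp.2 1 == x)%:Z - (mp.2 0 == x)%:Z) = 0) ->
  \sum_(mp <- s) mp.1%:~R * (f (mp.2 1) - f (mp.2 0)) = 0.
Proof.
move=> bs.
pose S := undup (flatten [seq [:: mp.2 0; mp.2 1] | mp <- s]).
have sS : all (fun mp : int * (R -> X) => (mp.2 0 \in S) && (mp.2 1 \in S)) s.
  have : {subset flatten [seq [:: mp.2 0; mp.2 1] | mp <- s] <= S}.
    by move=> x; rewrite mem_undup.
  elim: (s) => [//|mp r IH] /= sub; rewrite !sub ?inE ?eqxx ?orbT //=.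
  by apply: IH => x xr; apply: sub; rewrite !inE xr !orbT.
have ptE x : x \in S -> f x = \sum_(y <- S) (x == y)%:R * f y.
  move=> xS; rewrite (bigD1_seq x) ?undup_uniq //= eqxx mul1r big1 ?addr0 // => y.
  by rewrite eq_sym => /negbTE ->; rewrite mul0r.
transitivity (\sum_(x <- S)
    (\sum_(mp <- s) mp.1 * ((mp.2 1 == x)%:Z - (mp.2 0 == x)%:Z))%:~R * f x); last first.
  by rewrite big1 // => x _; rewrite bs mul0r.
clearbody S; elim: s sS {bs} => [_|[m p] r IH /= /andP[/andP[p0 p1] /IH{}IH]].
  by rewrite big_nil big1 // => x _; rewrite big_nil mul0r.
rewrite big_cons IH /= (ptE _ p0) (ptE _ p1) -sumrB mulr_sumr -big_split /=.
apply: eq_bigr => x _; rewrite big_cons /= intrD mulrDl; congr (_ + _).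
by rewrite intrM intrB -mulrBl mulrA.
Qed.

Lemma chain_int_exact s w f : open A -> C1_chain_in s -> differentiable_cycle s ->
  C1_in_charts A (fun=> f) ->
  (forall c x, atlas c -> cdom c x -> A x -> w c x = fun_d f c x) -> chain_int s w = 0.
Proof.
move=> oA sA [_ bs] f1 wf; rewrite (eq_chain_int sA wf) -[RHS](sum_boundary f bs).
apply: (eq_sum_chain (F := fun p => curve_int p (fun_d f))
  (G := fun p => f (p 1) - f (p 0))) => p /sA[p1 pA].
by rewrite (curve_int_fun_d oA p1 pA f1).
Qed.
End Chains.

(** * Connections on matrix functions *)

Section Matrices.
Variables (R : realType) (X : riemann_surface R) (A : set X) (oA : open A) (N : nat).
Local Notation C := R[i].
Local Notation chartX := (chart R X).
Implicit Types (L M : X -> 'M[C]_N) (e : chartX -> X -> C) (w : chartX -> X -> 'M[C]_N).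

Definition mx_C1_in_charts w := forall i j, C1_in_charts A (fun c x => w c x i j).

Lemma commutatorZl (a : C) (P Q : 'M[C]_N) :
  commutator (a *: P) Q = a *: commutator P Q.
Proof. by rewrite /commutator -scalemxAl -scalemxAr scalerBr. Qed.

Lemma mxtrace_commutator (P Q : 'M[C]_N) : \tr (commutator P Q) = 0.
Proof. by rewrite /commutator linearB /= mxtrace_mulC subrr. Qed.

(** Infinitesimal invariance of the trace form under [ad W]. *)
Lemma mxtrace_commutator_invariant (W P Q : 'M[C]_N) :
  \tr (commutator W P *m Q) + \tr (P *m commutator W Q) = 0.
Proof.
rewrite /commutator mulmxBl mulmxBr !linearB /= !mulmxA.
by rewrite (mxtrace_mulC (P *m Q) W) mulmxA addrA subrK subrr.
Qed.

Lemma fun_d_tr_mulmx L M c x : mx_C1_in_charts (fun=> L) -> mx_C1_in_charts (fun=> M) ->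
  atlas c -> cdom c x -> A x ->
  fun_d (fun y => \tr (L y *m M y)) c x =
  \tr (mx_d L c x *m M x) + \tr (L x *m mx_d M c x).
Proof.
move=> L1 M1 ac cx Ax.
have dL i j : cderivable ((fun y => L y i j) \o cinv c) (cmap c x).
  exact: C1_at_derivable (L1 i j c x ac cx Ax).
have dM i j : cderivable ((fun y => M y i j) \o cinv c) (cmap c x).
  exact: C1_at_derivable (M1 i j c x ac cx Ax).
rewrite /fun_d.
rewrite (_ : _ \o _ = fun z => \sum_i \sum_j
  ((fun y => L y i j) \o cinv c) z * ((fun y => M y j i) \o cinv c) z); last first.
  by apply/funext => z; rewrite /mxtrace /=; apply: eq_bigr => i _; rewrite mxE.
have dLM i j := cderivM (dL i j) (dM j i).
have dsum i := cderiv_sum (index_enum 'I_N) (fun j => (dLM i j).1).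
rewrite (cderiv_sum _ (fun i => (dsum i).1)).2 /mxtrace -big_split /=.
apply: eq_bigr => i _.
rewrite (dsum i).2 [(mx_d L c x *m _) i i]mxE [(L x *m _) i i]mxE -big_split /=.
apply: eq_bigr => j _.
apply: etrans (dLM i j).2 _.
have xK := chart_cinvK cx.
have dLE : cderiv ((fun y => L y i j) \o cinv c) (cmap c x) = mx_d L c x i j.
  by rewrite mxE.
have dME : cderiv ((fun y => M y j i) \o cinv c) (cmap c x) = mx_d M c x j i.
  by rewrite mxE.
by rewrite dLE dME /= xK.
Qed.

Lemma fun_d_tr L c x : mx_C1_in_charts (fun=> L) ->
  atlas c -> cdom c x -> A x ->
  fun_d (fun y => \tr (L y)) c x = \tr (mx_d L c x).
Proof.
move=> L1 ac cx Ax.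
have dL i j : cderivable ((fun y => L y i j) \o cinv c) (cmap c x).
  exact: C1_at_derivable (L1 i j c x ac cx Ax).
rewrite /fun_d (_ : _ \o _ = fun z => \sum_i ((fun y => L y i i) \o cinv c) z) //.
rewrite (cderiv_sum _ (fun i => dL i i)).2 /mxtrace.
by apply: eq_bigr => i _; rewrite mxE.
Qed.

Lemma C1_in_chartsM F G : C1_in_charts A F -> C1_in_charts A G ->
  C1_in_charts A (fun c x => F c x * G c x).
Proof.
move=> F1 G1 c x ac cx Ax; exact: C1_atM (F1 c x ac cx Ax) (G1 c x ac cx Ax).
Qed.

Lemma C1_in_charts_sum (I : finType) (F : I -> chartX -> X -> C) :
  (forall i, C1_in_charts A (F i)) -> C1_in_charts A (fun c x => \sum_i F i c x).
Proof.
move=> F1 c x ac cx Ax.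
exact: (@C1_at_sum _ _ (index_enum I) (fun i => F i c \o cinv c))
  (fun i => F1 i c x ac cx Ax).
Qed.

End Matrices.

Section Nabla.
Variables (R : realType) (X : riemann_surface R) (A : set X) (oA : open A).
Variables (T : lie_type) (n : nat).
Local Notation C := R[i].
Local Notation chartX := (chart R X).
Local Notation N := (lie_dim T n).
Implicit Types (L M : X -> 'M[C]_N) (e : chartX -> X -> C) (w : chartX -> X -> 'M[C]_N).
Local Notation mx_C1_in_charts := (@mx_C1_in_charts R X A N).

(** [dL] transforms by the chain rule and [w] by hypothesis. *)
Lemma nabla_continuous_form w L i j :
  is_form w -> mx_C1_in_charts w -> mx_C1_in_charts (fun=> L) ->
  continuous_form A (fun c x => nabla w L c x i j).
Proof.
move=> wf w1 L1.
have cw k l : continuous_form A (fun c x => w c x k l).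
  split=> [c c' x ac ac' cx cx' Ax|c x ac cx Ax].
    by rewrite (wf c c' x) // mxE.
  by rewrite -{2}(chart_cinvK cx); exact: C1_at_continuous (w1 k l c x ac cx Ax).
rewrite (_ : (fun c x => _) = fun c x => fun_d (fun y => L y i j) c x +
   (\sum_k L x k j * w c x i k + \sum_k - L x i k * w c x k j)); last first.
  apply/funext => c; apply/funext => x; rewrite !mxE -sumrN; congr (_ + (_ + _)).
    by apply: eq_bigr => k _; rewrite mulrC.
  by apply: eq_bigr => k _; rewrite mulNr.
apply: (continuous_formD (fun_d_continuous_form oA (L1 i j))).
apply: (continuous_formD (continuous_form_sum _ _) (continuous_form_sum _ _)) => k.
  exact: continuous_formM (L1 k j) (cw i k).
apply: continuous_formM (cw k j) => c x ac cx Ax.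
exact: C1_atN (L1 i k c x ac cx Ax).
Qed.

(** The transition factors of the vector field and of the form are inverse to each
    other, so that the chart [chart_at x] may be replaced by any other: near a
    point, [nabla_along w e L] is a product of coefficients in a single chart. *)
Lemma nabla_along_chart w e L c x :
  is_form w -> is_vector_field e -> mx_C1_in_charts w -> mx_C1_in_charts (fun=> L) ->
  atlas c -> cdom c x -> A x -> nabla_along w e L x = e c x *: nabla w L c x.
Proof.
move=> wf ev w1 L1 ac cx Ax; set c0 := chart_at x.
have ac0 : atlas c0 by exact: chart_at_atlas.
have cx0 : cdom c0 x by exact: chart_at_cdom.
have -> : nabla_along w e L x = e c0 x *: nabla w L c0 x.
  by rewrite /nabla_along /lie_deriv /contract commutatorZl -scalerDr.
have -> : nabla w L c0 x = cderiv (transition c0 c) (cmap c0 x) *: nabla w L c x.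
  apply/matrixP => i j; rewrite [RHS]mxE.
  have [t _] := nabla_continuous_form i j wf w1 L1; exact: t.
by rewrite scalerA (ev c0 c x) // mulrC.
Qed.
End Nabla.

(** * Exactness of the invariance defect *)

Section Exactness.
Variables (R : realType) (X : riemann_surface R) (A : set X) (oA : open A).
Variables (T : lie_type) (n : nat).
Local Notation C := R[i].
Local Notation chartX := (chart R X).
Local Notation N := (lie_dim T n).
Implicit Types (L M : X -> 'M[C]_N) (e : chartX -> X -> C) (w : chartX -> X -> 'M[C]_N).
Local Notation mx_C1_in_charts := (@mx_C1_in_charts R X A N).

(** The coefficients of [mx_d L] in charts have a continuous derivative, like those
    of [L]: this regularity makes [nabla_along w e L] continuously differentiable. *)
Definition mx_C2 L := mx_C1_in_charts (fun=> L) /\ mx_C1_in_charts (fun c => mx_d L c).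

Lemma nabla_along_C1 w e L :
  is_form w -> is_vector_field e -> mx_C1_in_charts w -> C1_in_charts A e -> mx_C2 L ->
  mx_C1_in_charts (fun=> nabla_along w e L).
Proof.
move=> wf ev w1 e1 [L1 dL1] i j.
apply: (@eq_C1_in_charts _ _ _ oA (fun c x => e c x * (mx_d L c x i j +
    (\sum_k w c x i k * L x k j + - \sum_k L x i k * w c x k j)))).
  move=> c x ac cx Ax; rewrite (nabla_along_chart oA wf ev w1 L1 ac cx Ax).
  rewrite [RHS]mxE; congr (_ * _); rewrite /nabla [RHS]mxE; congr (_ + _).
  rewrite /commutator [RHS]mxE; congr (_ + _); rewrite [RHS]mxE //.
  by congr (- _); rewrite mxE.
apply: (C1_in_chartsM e1) => c x ac cx Ax.
apply: C1_atD; first exact: dL1.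
apply: C1_atD; last apply: C1_atN; apply: C1_at_sum => k; apply: C1_atM.
- exact: w1.
- exact: (L1 k j).
- exact: (L1 i k).
- exact: w1.
Qed.

Lemma tr_C1 P : mx_C1_in_charts (fun=> P) -> C1_in_charts A (fun=> fun x => \tr (P x)).
Proof. by move=> P1 c x ac cx Ax; apply: C1_at_sum => i; exact: (P1 i i). Qed.

Lemma tr_mulmx_C1 P L : mx_C1_in_charts (fun=> P) -> mx_C1_in_charts (fun=> L) ->
  C1_in_charts A (fun=> fun x => \tr (P x *m L x)).
Proof.
move=> P1 L1; apply: (@eq_C1_in_charts _ _ _ oA
    (fun=> fun x => \sum_i \sum_j P x i j * L x j i)).
  by move=> _ x _ _ _; apply: eq_bigr => i _; rewrite mxE.
apply: C1_in_charts_sum => i; apply: C1_in_charts_sum => j.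
exact: C1_in_chartsM (P1 i j) (L1 j i).
Qed.

Lemma tr_mulmx_nabla_continuous_form P w L :
  is_form w -> mx_C1_in_charts w -> mx_C1_in_charts (fun=> P) ->
  mx_C1_in_charts (fun=> L) -> continuous_form A (fun c x => \tr (P x *m nabla w L c x)).
Proof.
move=> wf w1 P1 L1.
rewrite (_ : (fun c x => _) = fun c x => \sum_i \sum_j P x i j * nabla w L c x j i).
  apply: continuous_form_sum => i; apply: continuous_form_sum => j.
  exact: continuous_formM (P1 i j) (nabla_continuous_form oA j i wf w1 L1).
by apply/funext => c; apply/funext => x; apply: eq_bigr => i _; rewrite mxE.
Qed.

Lemma tr_tr_nabla_continuous_form P w L :
  is_form w -> mx_C1_in_charts w -> mx_C1_in_charts (fun=> P) ->
  mx_C1_in_charts (fun=> L) ->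
  continuous_form A (fun c x => \tr (P x) * \tr (nabla w L c x)).
Proof.
move=> wf w1 P1 L1; apply: (@continuous_formM _ _ _ (fun x => \tr (P x))).
  exact: tr_C1.
by apply: continuous_form_sum => i; exact: nabla_continuous_form.
Qed.

Lemma tr_nabla w L c x : \tr (nabla w L c x) = \tr (mx_d L c x).
Proof. by rewrite /nabla linearD /= mxtrace_commutator addr0. Qed.

(** Write [M] for [nabla_along w e L'].  In a coordinate, moving the factor [e]
    from the left to the right of the first trace turns the two terms into
    [tr (nabla L * M) + tr (L * nabla M)]; the commutator parts cancel by
    invariance of the trace form, and the Leibniz rule for [tr (L * M)] remains.
    The cancellation requires the same form in both connections. *)
Lemma tr_nabla_exact w e L L' c x :
  is_form w -> is_vector_field e -> mx_C1_in_charts w -> C1_in_charts A e ->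
  mx_C2 L -> mx_C2 L' -> atlas c -> cdom c x -> A x ->
  \tr (nabla_along w e L x *m nabla w L' c x) +
  \tr (L x *m nabla w (nabla_along w e L') c x) =
  fun_d (fun y => \tr (L y *m nabla_along w e L' y)) c x.
Proof.
move=> wf ev w1 e1 L2 L2' ac cx Ax.
have M1 := nabla_along_C1 wf ev w1 e1 L2'.
rewrite (fun_d_tr_mulmx L2.1 M1 ac cx Ax).
rewrite (nabla_along_chart oA wf ev w1 L2.1 ac cx Ax).
have Mx := nabla_along_chart oA wf ev w1 L2'.1 ac cx Ax.
rewrite -scalemxAl scalemxAr -Mx; move: (nabla_along w e L') => M.
rewrite /nabla mulmxDl mulmxDr !mxtraceD addrACA.
by rewrite (mxtrace_commutator_invariant (w c x)) addr0.
Qed.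

Lemma fun_dM (f g : X -> C) c x : C1_in_charts A (fun=> f) -> C1_in_charts A (fun=> g) ->
  atlas c -> cdom c x -> A x ->
  fun_d (fun y => f y * g y) c x = fun_d f c x * g x + f x * fun_d g c x.
Proof.
move=> f1 g1 ac cx Ax.
have df : cderivable (f \o cinv c) (cmap c x) := C1_at_derivable (f1 c x ac cx Ax).
have dg : cderivable (g \o cinv c) (cmap c x) := C1_at_derivable (g1 c x ac cx Ax).
by apply: etrans (cderivM df dg).2 _; rewrite /= (chart_cinvK cx).
Qed.

(** Traces of commutators vanish, so both connections act on traces as [d] and [e]:
    what remains is the Leibniz rule for [tr L * (e . tr L')], whatever the two
    forms are. *)
Lemma tr_tr_nabla_exact w w' e L L' c x :
  is_form w' -> is_vector_field e -> mx_C1_in_charts w' -> C1_in_charts A e ->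
  mx_C2 L -> mx_C2 L' -> atlas c -> cdom c x -> A x ->
  \tr (nabla_along w' e L x) * \tr (nabla w L' c x) +
  \tr (L x) * \tr (nabla w (nabla_along w' e L') c x) =
  fun_d (fun y => \tr (L y) * \tr (nabla_along w' e L' y)) c x.
Proof.
move=> wf ev w1 e1 L2 L2' ac cx Ax.
have M1 := nabla_along_C1 wf ev w1 e1 L2'.
have tr_along P : mx_C2 P -> \tr (nabla_along w' e P x) = e c x * \tr (mx_d P c x).
  move=> P2; rewrite (nabla_along_chart oA wf ev w1 P2.1 ac cx Ax) mxtraceZ.
  by congr (_ * _); exact: tr_nabla.
transitivity (e c x * \tr (mx_d L c x) * \tr (mx_d L' c x) +
    \tr (L x) * \tr (mx_d (nabla_along w' e L') c x)).
  by congr (_ * _ + _ * _); [exact: tr_along | exact: tr_nabla | exact: tr_nabla].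
apply/esym; apply: etrans (fun_dM (tr_C1 L2.1) (tr_C1 M1) ac cx Ax) _.
rewrite (fun_d_tr L2.1 ac cx Ax) (fun_d_tr M1 ac cx Ax) mulrAC; congr (_ + _).
by rewrite mulrC; congr (_ * _); exact: tr_along.
Qed.

Lemma hol_mx_C2 L : (forall x, A x -> mx_hol_at (fun=> L) x) -> mx_C2 L.
Proof.
move=> hL; split=> i j; first by apply: hol_C1_in_charts => // x Ax; exact: hL.
apply: (@eq_C1_in_charts _ _ _ oA (fun_d (fun y => L y i j))).
  by move=> c x _ _ _; rewrite mxE.
by apply: hol_C1_fun_d => // x Ax; exact: hL.
Qed.
End Exactness.

(** * Invariance of the cocycles *)

(** The marked points are finitely many points of a Hausdorff space. *)
Lemma unmarked_open (R : realType) (X : riemann_surface R) (g n : nat)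
    (T : lie_type) (D : marking X g n T) : open (~` (marked_P D `|` marked_W D)).
Proof.
apply: closed_openC.
apply: (accessible_finite_set_closed.1 (hausdorff_accessible (@rs_hausdorff _ X))).
rewrite finite_setU; split; first exact: finite_set2.
by apply: finite_image; exact: finite_finset.
Qed.

Theorem proposition3p4 (R : realType) (X : riemann_surface R) (g n : nat)
    (T : lie_type) (D : marking X g n T)
    (w w' : chart R X -> X -> 'M[R[i]]_(lie_dim T n)) (s : chain X)
    (hcompact : compact [set: X]) (hgenus : has_genus X g)
    (hw : connection_form D w) (hw' : connection_form D w')
    (hs : differentiable_cycle s)
    (havoid : chain_avoids s (marked_P D `|` marked_W D)) :
  invariant_cocycle D w' (gamma2 w s) /\
  (w = w' -> invariant_cocycle D w' (gamma1 w s)).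
Proof.
pose A := ~` (marked_P D `|` marked_W D).
have oA : open A by exact: unmarked_open.
have sA : C1_chain_in A s.
  by move=> p ps; split; [exact: hs.1 | move=> t; exact: havoid].
have con v : connection_form D v -> is_form v /\ mx_C1_in_charts A v.
  move=> [vf _ vh _ _]; split=> // i j; apply: hol_C1_in_charts => // x Ax.
  by apply: vh => xm; apply: Ax; case: xm => [|->]; [right | left; right].
have lax L : lax_operator D L -> mx_C2 A L.
  by move=> [_ hL _ _]; exact: hol_mx_C2.
have vec e : mer_vector_field D e -> is_vector_field e /\ C1_in_charts A e.
  move=> [ef eh _]; split=> //; apply: hol_C1_in_charts => // x Ax.
  by apply: eh => xm; apply: Ax; left.
have [wf w1] := con _ hw; have [wf' w1'] := con _ hw'.
split=> [|ww'] e L L' /vec[ev e1] /lax L2 /lax L2';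
  have P1 := nabla_along_C1 oA wf' ev w1' e1 L2;
  have M1 := nabla_along_C1 oA wf' ev w1' e1 L2'.
  rewrite /gamma2 -mulrDr -(chain_intD sA); last 2 first.
  - exact: tr_tr_nabla_continuous_form L2'.1.
  - exact: tr_tr_nabla_continuous_form L2.1 M1.
  have f1 := C1_in_chartsM (tr_C1 L2.1) (tr_C1 M1).
  rewrite (chain_int_exact oA sA hs f1) ?mulr0 // => c x ac cx Ax.
  exact: (tr_tr_nabla_exact oA w wf' ev w1' e1 L2 L2' ac cx Ax).
rewrite -{}ww' in P1 M1 *.
rewrite /gamma1 -mulrDr -(chain_intD sA); last 2 first.
- exact: tr_mulmx_nabla_continuous_form L2'.1.
- exact: tr_mulmx_nabla_continuous_form L2.1 M1.
have f1 := tr_mulmx_C1 oA L2.1 M1.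
rewrite (chain_int_exact oA sA hs f1) ?mulr0 // => c x ac cx Ax.
exact: (tr_nabla_exact oA wf ev w1 e1 L2 L2' ac cx Ax).
Qed.
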